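(* Let $k$ be an integer with $k\geq 2$ and \[ R(n)=a_kn^k+\ldots+a_0 \] be a polynomial with integer coefficients, $a_k>0$. For any positive integer $n$, put \[ r(n)=\#\{(p,j)\in\mathbb{P}\times\mathbb{N}:\ p+R(j)=n\}. \] Then there are constants $c_1>0$, $c_2>0$, $x_0>0$, depending only on $R$, such that \[ \#\left\{1\leq n\leq x:\ r(n)\geq c_1\frac{x^{1/k}}{\ln x}\right\}\geq c_2x \] for any real number $x\geq x_0$.
   Context: $\mathbb{N}$ is the set of positive integers, $\mathbb{P}$ the set of prime numbers; the variable $n$ in the counted set runs over integers; $\ln$ is the natural logarithm. *)

(* Defs.v *)
From mathcomp Require Import all_boot all_order all_algebra.
From mathcomp Require Import finmap all_classical all_reals all_analysis.

Set Implicit Arguments.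
Unset Strict Implicit.
Unset Printing Implicit Defensive.

Import Order.TTheory GRing.Theory Num.Theory.

Local Open Scope ring_scope.
Local Open Scope classical_set_scope.

(* The equation is over int, since P.[j] may be negative for small j. *)
Definition reprs (P : {poly int}) (n : nat) : set (nat * nat) :=
  [set pj | [/\ prime pj.1, (0 < pj.2)%N & pj.1%:Z + P.[pj.2%:Z] = n%:Z]].

(* fset_set sends an infinite set to the empty one; finite_reprs below shows
   that this default is not reached for the polynomials of interest. *)
Definition r (P : {poly int}) (n : nat) : nat := #|` fset_set (reprs P n)|.

Definition rich (F : realType) (P : {poly int}) (k : nat) (c x : F) : set nat :=
  [set n | [/\ (1 <= n)%N, n%:R <= x & c * (x `^ k%:R^-1 / ln x) <= (r P n)%:R]].

Lemma poly_unbounded (P : {poly int}) (M : int) :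
  (1 < size P)%N -> 0 < lead_coef P ->
  exists J : nat, forall j : nat, (J <= j)%N -> M < P.[j%:Z].
Proof.
elim/poly_ind: P M => [|P c IH] M; first by rewrite size_poly0.
move=> sP lP.
have Pn0 : P != 0.
  apply/eqP => P0; move: sP; rewrite P0 mul0r add0r.
  by rewrite ltnNge size_polyC_leq1.
have lcP : 0 < lead_coef P.
  move: lP; rewrite lead_coefDl ?lead_coefMX //.
  rewrite size_mulX // (leq_ltn_trans (size_polyC_leq1 c)) //.
  by rewrite ltnS size_poly_gt0.
have [J HJ] : exists J : nat, forall j : nat, (J <= j)%N -> 0 < P.[j%:Z].
  have [s1|s1] := ltnP 1 (size P); first by apply: IH.
  exists 0%N => j _; move: lcP; rewrite (size1_polyC s1) lead_coefC.
  by rewrite hornerC.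
exists (maxn J `|M - c|.+1) => j; rewrite geq_max => /andP[Jj cj].
rewrite hornerD hornerMX hornerC -ltrBlDr.
apply: (@lt_le_trans _ _ j%:Z).
  by apply: le_lt_trans (ler_norm _) _; rewrite -abszE ltz_nat.
by rewrite ler_peMl // -gtz0_ge1 HJ.
Qed.

Lemma finite_reprs (P : {poly int}) (n : nat) :
  (1 < size P)%N -> 0 < lead_coef P -> finite_set (reprs P n).
Proof.
move=> sP lP; have [J HJ] := poly_unbounded n%:Z sP lP.
pose f (j : nat) := (`|n%:Z - P.[j%:Z]|%N, j).
apply: (@sub_finite_set _ _ (f @` `I_J)); last first.
  exact/finite_image/finite_II.
move=> [p j] [/= _ _ e]; exists j; last first.
  by rewrite /f -e addrK absz_nat.
rewrite /= ltnNge; apply/negP => /HJ; rewrite -e.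
by rewrite ltNge lerDr.
Qed.

Lemma finite_rich (F : realType) (P : {poly int}) (k : nat) (c x : F) :
  finite_set (rich P k c x).
Proof.
apply: (@sub_finite_set _ _ `I_(Num.truncn x).+1); last exact: finite_II.
move=> n [n1 nx _] /=; rewrite ltnS truncn_ge_nat //.
exact: le_trans nx.
Qed.

(* Main.v *)
Require Import Defs.
From mathcomp Require Import all_boot all_order all_algebra.
From mathcomp Require Import finmap all_classical all_reals all_analysis.
From mathcomp Require Import ring lra zify.
Import Order.TTheory GRing.Theory Num.Theory.
Set Implicit Arguments.
Unset Strict Implicit.
Unset Printing Implicit Defensive.
Local Open Scope ring_scope.

(** Let N be the integer part of x, choose y of order x^(1/k) such that
    0 < P(j) <= N/2 for y < j <= 2y, and let w(n) be the number of these j for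
    which n - P(j) is a prime exceeding z, where z is a small power of y.  Then
    w(n) <= r(n), and it is enough that, over 1 <= n <= N,
    - the mean of w is at least a constant times y / ln x, and
    - the mean of w^2 is at most a constant times (y / ln x)^2,
    because a function whose mean square is comparable to the square of its mean
    is comparable to its mean on a positive proportion of the points
    ([second_moment_count]).  The first claim is Chebyshev's lower bound for the
    number of primes ([chebyshev_lower], [first_moment_term]).

    The second one is a sieve bound ([second_moment_bound]).  The sum of w^2 is
    the number of triples (n, i, j) such that n - P(i) and n - P(j) are both
    primes exceeding z.  For fixed i and j an upper bound sieve would produce a
    singular series depending on P(i) - P(j), to be averaged afterwards.  Here
    the three variables are sieved together: a prime p <= z, unless it is below a
    constant depending on P, removes the triples with p | (n - P(i)) (n - P(j)), and since P(i) = P(j) (mod p) for at most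
    k p of the p^2 pairs of residues, the density g(p) of the removed residue
    classes is 2/p + O(1/p^2) ([sieved_density]), so that the averaging is done
    by the sieve itself.

    The sieve ([selberg_sieve], [box_sieve]) is Selberg's, written through
    orthogonality.  Put h(p) = g(p) / (1 - g(p)) and let psi_p be -1 on the
    triples removed by p and h(p) on the others.  On complete residue systems
    psi_p has mean 0 and mean square h(p), so the products psi_d of the psi_p
    over p | d, for squarefree d, are orthogonal with mean squares h(d).  The
    sum of psi_d over squarefree d <= z has mean square L = sum of the h(d), up
    to an error that is negligible when z is a small power of y, and it takes
    the value L at every triple that survives.  Hence the proportion of
    survivors is O(1/L).

    Finally L is at least a constant times ln^2 z ([sieve_sum_ge_ln2]): since
    2/(p + k) <= h(p) for large p, it can be compared with the square of a
    harmonic sum, adjoining the primes one at a time ([smooth_harmonic_le],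
    [smooth_sieve_sum_sqr]); each prime costs only a factor 1 + O(1/p^2). *)

(** * Means of periodic functions of one and three variables *)

Definition periodic (T : Type) (d : nat) (f : nat -> T) :=
  forall i, f (i + d)%N = f i.

Lemma periodic_modn (T : Type) (d : nat) (f : nat -> T) (i : nat) :
  periodic d f -> f i = f (i %% d)%N.
Proof.
move=> fd; rewrite {1}(divn_eq i d); elim: (i %/ d)%N => [//|q <-].
by rewrite mulSn -addnA addnC fd.
Qed.

Definition mean (R : realFieldType) (d : nat) (f : nat -> R) : R :=
  (\sum_(0 <= i < d) f i) / d%:R.

Lemma eq_mean (R : realFieldType) d (f g : nat -> R) :
  f =1 g -> mean d f = mean d g.
Proof. by move=> fg; rewrite /mean; under eq_bigr do rewrite fg. Qed.

Lemma meanD (R : realFieldType) d (f g : nat -> R) :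
  mean d (fun i => f i + g i) = mean d f + mean d g.
Proof. by rewrite /mean big_split mulrDl. Qed.

Lemma meanZ (R : realFieldType) d (c : R) (f : nat -> R) :
  mean d (fun i => c * f i) = c * mean d f.
Proof. by rewrite /mean -mulr_sumr mulrA. Qed.

Lemma mean_cst (R : realFieldType) d (c : R) :
  (0 < d)%N -> mean d (fun=> c) = c.
Proof.
move=> d0; rewrite /mean sumr_const_nat subn0 -[c *+ d]mulr_natr mulfK //.
by rewrite pnatr_eq0 -lt0n.
Qed.

Lemma ler_mean (R : realFieldType) d (f g : nat -> R) :
  (forall i, (i < d)%N -> f i <= g i) -> mean d f <= mean d g.
Proof.
move=> fg; rewrite /mean ler_wpM2r ?invr_ge0 ?ler0n //.
by rewrite !big_mkord ler_sum // => i _; apply: fg.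
Qed.

Lemma mean_norm_le1 (R : realFieldType) d (f : nat -> R) :
  (0 < d)%N -> (forall i, `|f i| <= 1) -> `|mean d f| <= 1.
Proof.
move=> d0 f1; rewrite ler_norml -{1}(mean_cst (-1 : R) d0).
rewrite -{2}(mean_cst (1 : R) d0).
by apply/andP; split; apply: ler_mean => i _;
  move: (f1 i); rewrite ler_norml => /andP[].
Qed.

(** The Chinese remainder theorem: i |-> (i mod a, i mod b) is a bijection from
    the residues modulo a b to pairs of residues. *)
Lemma mean_mul_coprime (R : realFieldType) (a b : nat) (f g : nat -> R) :
  (0 < a)%N -> (0 < b)%N -> coprime a b -> periodic a f -> periodic b g ->
  mean (a * b) (fun i => f i * g i) = mean a f * mean b g.
Proof.
move=> a0 b0 cab fa gb; rewrite /mean natrM invfM mulrACA; congr (_ * _).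
rewrite !big_mkord big_distrlr pair_big /=.
pose h (i : 'I_(a * b)) : 'I_a * 'I_b :=
  (Ordinal (ltn_pmod i a0), Ordinal (ltn_pmod i b0)).
have hinj : injective h.
  move=> i j [/eqP ea /eqP eb]; apply/val_inj => /=.
  have: (i == j %[mod a * b])%N by rewrite chinese_remainder // ea.
  by rewrite !modn_small // => /eqP.
rewrite (reindex h).
  by apply: eq_bigr => i _; rewrite /= -(periodic_modn _ fa) -(periodic_modn _ gb).
apply: onW_bij; apply: inj_card_bij => //.
by rewrite card_prod !card_ord.
Qed.

Definition mean3 (R : realFieldType) d (f : nat -> nat -> nat -> R) : R :=
  mean d (fun n => mean d (fun i => mean d (fun j => f n i j))).

Definition periodic3 (T : Type) d (f : nat -> nat -> nat -> T) :=
  forall n i j, [/\ f (n + d)%N i j = f n i j, f n (i + d)%N j = f n i j &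
                    f n i (j + d)%N = f n i j].

Lemma eq_mean3 (R : realFieldType) d (f g : nat -> nat -> nat -> R) :
  (forall n i j, f n i j = g n i j) -> mean3 d f = mean3 d g.
Proof.
by move=> fg; do 3![apply: eq_mean => ?]; apply: fg.
Qed.

Lemma mean3D (R : realFieldType) d (f g : nat -> nat -> nat -> R) :
  mean3 d (fun n i j => f n i j + g n i j) = mean3 d f + mean3 d g.
Proof.
rewrite /mean3 -meanD; apply: eq_mean => n; rewrite -meanD; apply: eq_mean => i.
exact: meanD.
Qed.

Lemma mean3Z (R : realFieldType) d (c : R) (f : nat -> nat -> nat -> R) :
  mean3 d (fun n i j => c * f n i j) = c * mean3 d f.
Proof.
rewrite /mean3 -meanZ; apply: eq_mean => n; rewrite -meanZ; apply: eq_mean => i.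
exact: meanZ.
Qed.

Lemma mean3_cst (R : realFieldType) d (c : R) :
  (0 < d)%N -> mean3 d (fun _ _ _ => c) = c.
Proof.
move=> d0; rewrite /mean3 -[RHS](mean_cst c d0); apply: eq_mean => n.
by rewrite !mean_cst.
Qed.

Lemma mean3_mul_coprime (R : realFieldType) (a b : nat)
    (f g : nat -> nat -> nat -> R) :
  (0 < a)%N -> (0 < b)%N -> coprime a b -> periodic3 a f -> periodic3 b g ->
  mean3 (a * b) (fun n i j => f n i j * g n i j) = mean3 a f * mean3 b g.
Proof.
move=> a0 b0 cab fa gb; rewrite /mean3.
under eq_mean => n.
  under eq_mean => i.
    rewrite mean_mul_coprime //; last 2 first.
    - by move=> j; case: (fa n i j).
    - by move=> j; case: (gb n i j).
    over.
  rewrite mean_mul_coprime //; last 2 first.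
  - by move=> i; apply: eq_mean => j; case: (fa n i j).
  - by move=> i; apply: eq_mean => j; case: (gb n i j).
  over.
rewrite mean_mul_coprime // => n; apply: eq_mean => i; apply: eq_mean => j.
- by case: (fa n i j).
- by case: (gb n i j).
Qed.

Lemma periodic3_prod (R : realFieldType) (s : seq nat)
    (f : nat -> nat -> nat -> nat -> R) :
  (forall p, p \in s -> periodic3 p (f p)) ->
  periodic3 (\prod_(p <- s) p)%N (fun n i j => \prod_(p <- s) f p n i j).
Proof.
move=> fs n i j.
have per p q : p \in s -> [/\ f p (n + p * q)%N i j = f p n i j,
    f p n (i + p * q)%N j = f p n i j & f p n i (j + p * q)%N = f p n i j].
  move=> ps; elim: q => [|q [IH1 IH2 IH3]]; first by rewrite muln0 !addn0.
  rewrite mulnSr !addnA; split.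
  - by case: (fs p ps (n + p * q)%N i j) => ->.
  - by case: (fs p ps n (i + p * q)%N j) => _ ->.
  - by case: (fs p ps n i (j + p * q)%N) => _ _ ->.
have dv p : p \in s -> exists q, (\prod_(p <- s) p)%N = (p * q)%N.
  by move=> ps; exists (\prod_(q <- rem p s) q)%N; rewrite (big_rem p).
by split; apply: eq_big_seq => p ps; have [q ->] := dv p ps; case: (per p q ps).
Qed.

Lemma coprime_prod_primes (p : nat) (s : seq nat) :
  prime p -> all prime s -> p \notin s -> coprime p (\prod_(q <- s) q)%N.
Proof.
move=> pp; elim: s => [|q s IH] /=; first by rewrite big_nil coprimen1.
move=> /andP[pq sp]; rewrite inE negb_or => /andP[npq nps].
by rewrite big_cons coprimeMr IH // prime_coprime // dvdn_prime2 // npq.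
Qed.

Lemma prod_primes_gt0 (s : seq nat) : all prime s -> (0 < \prod_(p <- s) p)%N.
Proof.
elim: s => [|p s IH] /=; first by rewrite big_nil.
by move=> /andP[pp /IH s0]; rewrite big_cons muln_gt0 s0 prime_gt0.
Qed.

Lemma mean3_prod (R : realFieldType) (s : seq nat)
    (f : nat -> nat -> nat -> nat -> R) :
  uniq s -> all prime s -> (forall p, p \in s -> periodic3 p (f p)) ->
  mean3 (\prod_(p <- s) p)%N (fun n i j => \prod_(p <- s) f p n i j) =
  \prod_(p <- s) mean3 p (f p).
Proof.
elim: s => [|p s IH] /=.
  move=> _ _ _; rewrite !big_nil -[RHS](@mean3_cst R 1%N) //.
  by apply: eq_mean3 => n i j; rewrite big_nil.
move=> /andP[nps us] /andP[pp sp] fs; rewrite !big_cons -IH //; last first.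
  by move=> q qs; apply: fs; rewrite inE qs orbT.
rewrite -mean3_mul_coprime ?prod_primes_gt0 ?prime_gt0 //; last 3 first.
- exact: coprime_prod_primes.
- by apply: fs; rewrite mem_head.
- by apply: periodic3_prod => q qs; apply: fs; rewrite inE qs orbT.
by apply: eq_mean3 => n i j; rewrite big_cons.
Qed.

Lemma sum_full_period (R : realFieldType) (d a : nat) (f : nat -> R) :
  (0 < d)%N -> periodic d f -> \sum_(a <= i < a + d) f i = d%:R * mean d f.
Proof.
move=> d0 fd; rewrite /mean mulrC mulfVK ?pnatr_eq0 -?lt0n //.
elim: a => [//|a <-]; rewrite addSn.
rewrite big_nat_recr /=; last by lia.
by rewrite fd addrC [RHS]big_ltn //; lia.
Qed.

(** Full periods contribute exactly their length times the mean, so only an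
    incomplete period, of less than d terms, matters. *)
Lemma sum_periodic (R : realFieldType) (d a N : nat) (f : nat -> R) :
  (0 < d)%N -> periodic d f -> (forall i, `|f i| <= 1) ->
  `|\sum_(a <= i < a + N) f i - N%:R * mean d f| <= 2 * d%:R.
Proof.
move=> d0 fd f1; elim/ltn_ind: N => N IH.
have [Nd|dN] := ltnP N d.
  have sN : `|\sum_(a <= i < a + N) f i| <= N%:R.
    apply: le_trans (ler_norm_sum _ _ _) _.
    apply: (@le_trans _ _ (\sum_(a <= i < a + N) 1)).
      by apply: ler_sum => i _; apply: f1.
    by rewrite sumr_const_nat addKn.
  have mN : `|N%:R * mean d f| <= N%:R.
    by rewrite normrM normr_nat ler_piMr // mean_norm_le1.
  apply: le_trans (ler_normB _ _) _.
  have : N%:R <= d%:R :> R by rewrite ler_nat ltnW.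
  by lra.
have -> : \sum_(a <= i < a + N) f i - N%:R * mean d f =
   \sum_(a <= i < a + (N - d)) f i - (N - d)%:R * mean d f.
  rewrite (@big_cat_nat _ _ _ (a + (N - d))%N) /= ?leq_addr //; last first.
    by rewrite leq_add2l leq_subr.
  have -> : (a + N = a + (N - d) + d)%N by rewrite -addnA subnK.
  by rewrite (@sum_full_period _ d) // natrB //; ring.
by apply: IH; rewrite ltn_subrL d0 (leq_trans d0 dN).
Qed.

(** [sum_periodic] applied in each variable in turn gives an error of
    2 d (N y + N y + y^2), and y <= N bounds the last term. *)
Lemma sum3_periodic (R : realFieldType) (d a b N y : nat)
    (f : nat -> nat -> nat -> R) :
  (0 < d)%N -> (y <= N)%N -> periodic3 d f -> (forall n i j, `|f n i j| <= 1) ->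
  `|\sum_(a <= n < a + N) \sum_(b <= i < b + y) \sum_(b <= j < b + y) f n i j
    - (N * y * y)%:R * mean3 d f| <= 6 * d%:R * (N * y)%:R.
Proof.
move=> d0 yN fd f1.
pose g1 n i := mean d (fun j => f n i j).
pose g2 n := mean d (fun i => g1 n i).
have g1le n i : `|g1 n i| <= 1 by apply: mean_norm_le1.
have g2le n : `|g2 n| <= 1 by apply: mean_norm_le1.
have e1 n i : `|\sum_(b <= j < b + y) f n i j - y%:R * g1 n i| <= 2 * d%:R.
  by apply: sum_periodic => // j; case: (fd n i j).
have e2 n : `|\sum_(b <= i < b + y) g1 n i - y%:R * g2 n| <= 2 * d%:R.
  apply: sum_periodic => // i; rewrite /g1; apply: eq_mean => j.
  by case: (fd n i j).
have e3 : `|\sum_(a <= n < a + N) g2 n - N%:R * mean3 d f| <= 2 * d%:R.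
  apply: sum_periodic => // n; apply: eq_mean => i; apply: eq_mean => j.
  by case: (fd n i j).
have sumle (A B : nat -> R) c M t : (forall i, `|A i - B i| <= c) ->
    `|\sum_(t <= i < t + M) A i - \sum_(t <= i < t + M) B i| <= M%:R * c.
  move=> AB; rewrite -sumrB; apply: le_trans (ler_norm_sum _ _ _) _.
  apply: le_trans (ler_sum _ (fun i _ => AB i)) _.
  by rewrite sumr_const_nat addKn mulr_natl.
have s2 n : `|\sum_(b <= i < b + y) \sum_(b <= j < b + y) f n i j -
     y%:R * (y%:R * g2 n)| <= 4 * d%:R * y%:R.
  have := sumle _ _ _ y b (e1 n); rewrite -mulr_sumr => h.
  have h2 : `|y%:R * \sum_(b <= i < b + y) g1 n i - y%:R * (y%:R * g2 n)|
      <= y%:R * (2 * d%:R).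
    by rewrite -mulrBr normrM normr_nat ler_wpM2l.
  by apply: le_trans (ler_distD _ _ _) _; apply: le_trans (lerD h h2) _; lra.
have := sumle _ _ _ N a s2; rewrite -!mulr_sumr => h.
have h2 : `|y%:R * (y%:R * \sum_(a <= n < a + N) g2 n)
     - y%:R * (y%:R * (N%:R * mean3 d f))| <= y%:R * (y%:R * (2 * d%:R)).
  by rewrite -!mulrBr !normrM !normr_nat !ler_wpM2l.
have -> : (N * y * y)%:R * mean3 d f = y%:R * (y%:R * (N%:R * mean3 d f)).
  by rewrite !natrM; ring.
apply: le_trans (ler_distD _ _ _) _; apply: le_trans (lerD h h2) _.
have : y%:R * (y%:R * (2 * d%:R)) <= N%:R * (y%:R * (2 * d%:R)) :> R.
  by rewrite ler_wpM2r ?ler_nat ?mulr_ge0.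
by rewrite natrM; lra.
Qed.

(** * The Selberg sieve in a box *)

(** [primes d] lists each prime divisor of d once. *)
Definition squarefree (d : nat) : bool := d == (\prod_(p <- primes d) p)%N.

(** The multiplicative function of d that depends only on the prime divisors
    of d, with the value h p at a prime p. *)
Definition primeprod (R : realFieldType) (h : nat -> R) (d : nat) : R :=
  \prod_(p <- primes d) h p.

(** The quantity L whose inverse is the saving in Selberg's sieve. *)
Definition sieve_sum (R : realFieldType) (h : nat -> R) (z : nat) : R :=
  \sum_(1 <= d < z.+1 | squarefree d) primeprod h d.

(** The factor psi_p: with h = g / (1 - g), where g is the density of the
    event b, its mean is h (1 - g) - g = 0. *)
Definition balanced (R : realFieldType) (h : R) (b : bool) : R :=
  if b then - 1 else h.

(** The sum over squarefree d <= z of the products of the balanced factors is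
    equal to [sieve_sum h z] at every good point, hence its mean square bounds
    the proportion of good points.  Expanding this mean square leaves the
    diagonal d = e, because distinct d and e give nearly orthogonal functions on
    X (up to [eps]). *)
Lemma selberg_sieve (R : realFieldType) (T : Type) (X : seq T) (z : nat)
    (bad : nat -> T -> bool) (good : pred T) (h : nat -> R) (eps : R) :
  0 <= eps ->
  (forall x p, good x -> prime p -> (p <= z)%N -> ~~ bad p x) ->
  (forall d e, (0 < d <= z)%N -> (0 < e <= z)%N -> squarefree d -> squarefree e ->
    `|\sum_(x <- X) (primeprod (fun p => balanced (h p) (bad p x)) d *
                    primeprod (fun p => balanced (h p) (bad p x)) e)
      - (size X)%:R * ((d == e)%:R * primeprod h d)| <= eps) ->
  (\sum_(x <- X) (good x)%:R) * sieve_sum h z ^+ 2 <=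
    (size X)%:R * sieve_sum h z + z%:R ^+ 2 * eps.
Proof.
move=> eps0 hgood hcor.
pose w x d := primeprod (fun p => balanced (h p) (bad p x)) d.
pose D := [seq d <- index_iota 1 z.+1 | squarefree d].
have DP d : d \in D -> (0 < d <= z)%N && squarefree d.
  by rewrite mem_filter mem_index_iota ltnS andbC.
have sD : sieve_sum h z = \sum_(d <- D) primeprod h d by rewrite big_filter.
have Dz : (size D <= z)%N.
  by rewrite size_filter (leq_trans (count_size _ _)) // size_iota subSS subn0.
have step1 : (\sum_(x <- X) (good x)%:R) * sieve_sum h z ^+ 2 <=
   \sum_(x <- X) (\sum_(d <- D) w x d) ^+ 2.
  rewrite mulr_suml; apply: ler_sum => x _.
  case gx: (good x); last by rewrite mul0r sqr_ge0.
  rewrite mul1r sD; suff -> : \sum_(d <- D) w x d = \sum_(d <- D) primeprod h d by [].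
  apply: eq_big_seq => d /DP /andP[/andP[d0 dz] _].
  apply: eq_big_seq => p; rewrite mem_primes => /and3P[pp _ pd].
  by rewrite /balanced (negbTE (hgood _ _ gx pp _)) // (leq_trans (dvdn_leq d0 pd)).
(* The square is expanded; correlations over X are replaced by main terms. *)
apply: le_trans step1 _.
have -> : \sum_(x <- X) (\sum_(d <- D) w x d) ^+ 2 =
   \sum_(d <- D) \sum_(e <- D) \sum_(x <- X) w x d * w x e.
  under eq_bigr do rewrite expr2 big_distrlr /=.
  by rewrite exchange_big; apply: eq_bigr => d _; rewrite exchange_big.
apply: (@le_trans _ _ (\sum_(d <- D) \sum_(e <- D)
    ((size X)%:R * ((d == e)%:R * primeprod h d) + eps))).
  rewrite big_seq [leRHS]big_seq; apply: ler_sum => d /DP /andP[dz sd].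
  rewrite big_seq [leRHS]big_seq; apply: ler_sum => e /DP /andP[ez se].
  have := hcor d e dz ez sd se; rewrite -/(w _ _) ler_norml.
  by rewrite lerBlDl => /andP[_]; rewrite addrC.
under eq_bigr do rewrite big_split /=.
rewrite big_split /= sD lerD //.
  rewrite mulr_sumr big_seq [leRHS]big_seq; apply: ler_sum => d dD.
  rewrite (bigD1_seq d) //= ?filter_uniq ?iota_uniq // eqxx mul1r big1 ?addr0 //.
  by move=> e ed; rewrite eq_sym (negbTE ed) mul0r mulr0.
under eq_bigr do rewrite big_const_seq count_predT iter_addr_0.
rewrite big_const_seq count_predT iter_addr_0 -mulrnA -[leLHS]mulr_natl.
by rewrite ler_wpM2r // -natrX ler_nat expnS expn1 leq_mul.
Qed.

Lemma prod_primes_dvd (d : nat) : (0 < d)%N -> (\prod_(p <- primes d) p %| d)%N.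
Proof.
move=> d0.
suff H s : uniq s -> all prime s -> all (dvdn^~ d) s -> (\prod_(p <- s) p %| d)%N.
  by apply: H; rewrite ?primes_uniq //; apply/allP => p;
    rewrite mem_primes => /and3P[].
elim: s => [|p s IH] /=; first by rewrite big_nil dvd1n.
move=> /andP[nps us] /andP[pp sp] /andP[pd sd]; rewrite big_cons.
by rewrite Gauss_dvd ?pd ?IH // coprime_prod_primes.
Qed.

Lemma primeprod_widen (R : realFieldType) (f : nat -> R) (s : seq nat) (d : nat) :
  uniq s -> {subset primes d <= s} ->
  primeprod f d = \prod_(p <- s) (if p \in primes d then f p else 1).
Proof.
move=> us ds; rewrite -big_mkcond /= -big_filter; apply: perm_big.
apply: uniq_perm; rewrite ?filter_uniq ?primes_uniq // => p.
by rewrite mem_filter; apply/idP/andP => [pd|[]//]; split=> //; apply: ds.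
Qed.

Lemma primeprod_mul (R : realFieldType) (u : nat -> R) (d e : nat) :
  (0 < d)%N -> (0 < e)%N ->
  primeprod u d * primeprod u e = \prod_(p <- primes (d * e))
    ((if p \in primes d then u p else 1) * (if p \in primes e then u p else 1)).
Proof.
move=> d0 e0; rewrite big_split -!primeprod_widen ?primes_uniq // => p;
  by rewrite primesM // => ->; rewrite ?orbT.
Qed.

(** By [mean3_prod] the mean is a product over the primes p dividing d e.  A
    prime dividing only one of d and e contributes the mean of a balanced
    factor, which is 0; if there is none, then d = e. *)
Lemma mean3_balanced_orthogonal (R : realFieldType) (h : nat -> R)
    (bad : nat -> nat -> nat -> nat -> bool) (d e : nat) :
  (forall p, prime p -> periodic3 p (bad p)) ->
  (forall p, prime p -> mean3 p (fun n i j => balanced (h p) (bad p n i j)) = 0) ->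
  (forall p, prime p ->
     mean3 p (fun n i j => balanced (h p) (bad p n i j) ^+ 2) = h p) ->
  (0 < d)%N -> (0 < e)%N -> squarefree d -> squarefree e ->
  mean3 (\prod_(p <- primes (d * e)) p)%N
    (fun n i j => primeprod (fun p => balanced (h p) (bad p n i j)) d *
                  primeprod (fun p => balanced (h p) (bad p n i j)) e) =
  (d == e)%:R * primeprod h d.
Proof.
move=> per m1 m2 d0 e0 sd se.
set s := primes (d * e).
have us : uniq s by exact: primes_uniq.
have ps : all prime s by apply/allP => p; rewrite mem_primes => /and3P[].
pose f p n i j : R := (if p \in primes d then balanced (h p) (bad p n i j) else 1) *
   (if p \in primes e then balanced (h p) (bad p n i j) else 1).
have -> : mean3 (\prod_(p <- s) p)%N
    (fun n i j => primeprod (fun p => balanced (h p) (bad p n i j)) d *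
                  primeprod (fun p => balanced (h p) (bad p n i j)) e) =
   mean3 (\prod_(p <- s) p)%N (fun n i j => \prod_(p <- s) f p n i j).
  by apply: eq_mean3 => n i j; apply: primeprod_mul.
rewrite mean3_prod //; last first.
  move=> p /(allP ps) pp n i j; rewrite /f.
  by case: (per p pp n i j) => -> -> ->.
have fE p : p \in s -> mean3 p (f p) = if (p \in primes d) == (p \in primes e)
    then h p else 0.
  move=> pis; have pp := allP ps _ pis; rewrite /f.
  have := pis; rewrite /s primesM //.
  case pd: (p \in primes d); case pe: (p \in primes e) => //= _.
  - by rewrite m2.
  - by rewrite -[RHS](m1 p pp); apply: eq_mean3 => *; rewrite mulr1.
  - by rewrite -[RHS](m1 p pp); apply: eq_mean3 => *; rewrite mul1r.
have [de|de] := eqVneq d e.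
  rewrite mul1r -de in fE *.
  rewrite (@primeprod_widen _ _ s) // => [|p]; last by rewrite /s primesM // => ->.
  apply: eq_big_seq => p pis; rewrite fE // eqxx.
  by move: pis; rewrite /s -de primesM // orbb => ->.
rewrite mul0r.
have : ~~ all (fun p => (p \in primes d) == (p \in primes e)) s.
  apply: contra de => /allP H.
  suff E : primes d = primes e by rewrite (eqP sd) (eqP se) E.
  apply/eq_primes => p; have [pis|] := boolP (p \in s); first by apply/eqP/H.
  by rewrite /s primesM // negb_or => /andP[/negbTE-> /negbTE->].
case/allPn => p pis np; rewrite (big_rem p) //= fE // (negbTE np) mul0r //.
Qed.

(** The weight h(p) of Selberg's sieve, as a function of the density removed
    by p. *)
Definition density_odds (R : realFieldType) (g : R) : R := g / (1 - g).

Lemma mean3_balanced (R : realFieldType) (p : nat) (b : nat -> nat -> nat -> bool) :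
  (0 < p)%N -> mean3 p (fun n i j => (b n i j)%:R : R) != 1 ->
  let h : R := density_odds (mean3 p (fun n i j => (b n i j)%:R)) in
  mean3 p (fun n i j => balanced h (b n i j)) = 0 /\
  mean3 p (fun n i j => balanced h (b n i j) ^+ 2) = h.
Proof.
move=> p0; set g := mean3 p _ => g1 h.
have g1' : 1 - g != 0 by rewrite subr_eq0 eq_sym.
have hE : h = g / (1 - g) by [].
split.
  transitivity (mean3 p (fun n i j => h + (- 1 - h) * (b n i j)%:R)).
    by apply: eq_mean3 => n i j; rewrite /balanced; case: (b n i j) => /=; ring.
  by rewrite mean3D mean3_cst // mean3Z -/g hE; field.
transitivity (mean3 p (fun n i j => h ^+ 2 + (1 - h ^+ 2) * (b n i j)%:R)).
  by apply: eq_mean3 => n i j; rewrite /balanced; case: (b n i j) => /=; ring.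
by rewrite mean3D mean3_cst // mean3Z -/g hE; field.
Qed.

Lemma balanced_norm_le1 (R : realFieldType) (h : R) (b : bool) :
  0 <= h <= 1 -> `|balanced h b| <= 1.
Proof.
move=> /andP[h0 h1]; case: b; rewrite /balanced ?normrN1 //.
by rewrite ger0_norm.
Qed.

Lemma prod_norm_le1 (R : realFieldType) (s : seq nat) (f : nat -> R) :
  (forall p, p \in s -> `|f p| <= 1) -> `|\prod_(p <- s) f p| <= 1.
Proof.
move=> f1; rewrite normr_prod big_seq; apply: prodr_ile1 => p ps.
by rewrite normr_ge0 f1.
Qed.

(** Selberg's sieve for triples in a box of sides N, y, y.  A pair (d, e)
    has period at most z^2, hence an error of at most 6 z^2 N y; the z^2 pairs
    together contribute at most 6 z^4 N y <= N y^2, which is no more than the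
    main term. *)
Lemma box_sieve (R : realFieldType) (a b N y z : nat)
    (bad : nat -> nat -> nat -> nat -> bool)
    (good : nat -> nat -> nat -> bool) :
  let g p : R := mean3 p (fun n i j => (bad p n i j)%:R) in
  let L := sieve_sum (fun p => density_odds (g p)) z in
  (y <= N)%N -> (6 * z ^ 4 <= y)%N -> (0 < z)%N ->
  (forall p, prime p -> periodic3 p (bad p)) ->
  (forall p, prime p -> 0 <= g p <= 2^-1) ->
  (forall n i j p, good n i j -> prime p -> (p <= z)%N -> ~~ bad p n i j) ->
  (\sum_(a <= n < a + N) \sum_(b <= i < b + y) \sum_(b <= j < b + y)
     (good n i j)%:R) * L <= 2 * (N * y * y)%:R.
Proof.
move=> g L yN zy z0 per g2 hgood.
set h := fun p => density_odds (g p) in L *.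
have h01 p : prime p -> 0 <= h p <= 1.
  move=> /g2 /andP[gp0 gp1]; rewrite /h /density_odds.
  have gp : 0 < 1 - g p by rewrite subr_gt0 (le_lt_trans gp1) // invf_lt1 // ltr1n.
  rewrite divr_ge0 ?(ltW gp) // ler_pdivrMr // mul1r; lra.
have m p : prime p -> mean3 p (fun n i j => balanced (h p) (bad p n i j)) = 0 /\
    mean3 p (fun n i j => balanced (h p) (bad p n i j) ^+ 2) = h p.
  move=> pp; apply: mean3_balanced; first exact: prime_gt0.
  rewrite lt_eqF //; have /andP[_ gp] := g2 p pp.
  by apply: le_lt_trans gp _; lra.
pose X := [seq (n, q) | n <- index_iota a (a + N),
   q <- [seq (i, j) | i <- index_iota b (b + y), j <- index_iota b (b + y)]].
have sX (F : nat * (nat * nat) -> R) : \sum_(x <- X) F x =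
   \sum_(a <= n < a + N) \sum_(b <= i < b + y) \sum_(b <= j < b + y) F (n, (i, j)).
  by rewrite big_allpairs; apply: eq_bigr => n _; rewrite big_allpairs.
have szX : size X = (N * y * y)%N by rewrite !size_allpairs !size_iota !addKn mulnA.
have L1 : 1 <= L.
  rewrite /L /sieve_sum big_ltn_cond ?ltnS //.
  rewrite /squarefree big_nil /= /primeprod big_nil lerDl.
  apply: sumr_ge0 => d _; rewrite big_seq; apply: prodr_ge0 => p.
  by rewrite mem_primes => /and3P[/h01 /andP[]].
have := @selberg_sieve R _ X z (fun p x => bad p x.1 x.2.1 x.2.2)
   (fun x => good x.1 x.2.1 x.2.2) h (6 * (z ^ 2)%:R * (N * y)%:R).
rewrite sX szX /= -/L => /(_ _ _ _) H.
have {}H : (\sum_(a <= n < a + N) \sum_(b <= i < b + y) \sum_(b <= j < b + y)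
     (good n i j)%:R) * L ^+ 2 <=
  (N * y * y)%:R * L + z%:R ^+ 2 * (6 * (z ^ 2)%:R * (N * y)%:R).
  apply: H => [|x p gx pp pz|d e /andP[d0 dz] /andP[e0 ez] sd se].
  - by rewrite !mulr_ge0.
  - exact: hgood gx pp pz.
  rewrite sX -(mean3_balanced_orthogonal per (fun p pp => (m p pp).1)
     (fun p pp => (m p pp).2)) //.
  have q0 : (0 < \prod_(p <- primes (d * e)) p)%N.
    by apply: prod_primes_gt0; apply/allP => p; rewrite mem_primes => /and3P[].
  apply: le_trans (sum3_periodic _ _ q0 yN _ _) _.
  - move=> n i j; rewrite !primeprod_mul //.
    pose v p n i j : R := balanced (h p) (bad p n i j).
    pose u p n i j := (if p \in primes d then v p n i j else 1) *
                      (if p \in primes e then v p n i j else 1).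
    apply: (periodic3_prod (f := u)) => p; rewrite mem_primes => /and3P[pp _ _].
    by move=> n' i' j'; rewrite /u /v; case: (per p pp n' i' j') => -> -> ->.
  - move=> n i j; rewrite normrM -[leRHS]mul1r ler_pM //; apply: prod_norm_le1 => p;
      by rewrite mem_primes => /and3P[pp _ _]; apply/balanced_norm_le1/h01.
  rewrite ler_wpM2r // ler_wpM2l // ler_nat.
  apply: leq_trans (dvdn_leq _ (prod_primes_dvd _)) _; rewrite ?muln_gt0 ?d0 //.
  by rewrite expnS expn1 leq_mul.
have E : z%:R ^+ 2 * (6 * (z ^ 2)%:R * (N * y)%:R) <= (N * y * y)%:R :> R.
  rewrite -!natrX -!natrM ler_nat.
  have -> : (z ^ 2 * (6 * z ^ 2 * (N * y)) = N * y * (6 * z ^ 4))%N.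
    by rewrite (expnD z 2 2) ; ring.
  by rewrite leq_mul.
have L0 : 0 < L by apply: lt_le_trans L1.
rewrite -(ler_pM2r L0) -mulrA -expr2; apply: le_trans H _.
have : (N * y * y)%:R <= (N * y * y)%:R * L :> R by rewrite ler_peMr.
by lra.
Qed.

(** * Lower bound for the sieve sum, one prime at a time *)

(** Restricting a sum to the integers that are smooth with respect to a list of
    primes allows primes to be adjoined one at a time. *)
Definition smooth_sum (R : realFieldType) (l : seq nat) (u : nat) (F : nat -> R) : R :=
  \sum_(1 <= n < u.+1 | all (mem l) (primes n)) F n.

Lemma smooth_sum_nil (R : realFieldType) (u : nat) (F : nat -> R) :
  smooth_sum [::] u F = (0 < u)%:R * F 1%N.
Proof.
rewrite /smooth_sum; case: u => [|u]; first by rewrite big_geq ?mul0r.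
rewrite big_ltn_cond //= mul1r big_nat_cond big_pred0 ?addr0 // => n.
apply/negP => /andP[/andP[n1 _]].
case E: (primes n) => [|p s] //; move: (primes_eq0 n).
by rewrite E eqxx ltnNge n1.
Qed.

Lemma smooth_cons_coprime (l : seq nat) (p n : nat) :
  prime p -> p \notin l -> (0 < n)%N ->
  all (mem (p :: l)) (primes n) && ~~ (p %| n)%N = all (mem l) (primes n).
Proof.
move=> pp pl n0; apply/andP/allP => [[/allP A npn] q qn|A].
  have := A q qn; rewrite /= inE => /orP[/eqP qp|//].
  by move: qn npn; rewrite qp mem_primes => /and3P[_ _ ->].
split; first by apply/allP => q /A /= ql; rewrite inE ql orbT.
by apply: contra pl => pn; apply: A; rewrite mem_primes pp n0 pn.
Qed.

Lemma smooth_cons_mul (l : seq nat) (p n : nat) :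
  prime p -> (0 < n)%N ->
  all (mem (p :: l)) (primes (p * n)) = all (mem (p :: l)) (primes n).
Proof.
move=> pp n0; have p0 := prime_gt0 pp.
apply/allP/allP => A q qn; first by apply: A; rewrite primesM // qn orbT.
move: qn; rewrite primesM // => /orP[|/A //].
by rewrite primes_prime // !inE => ->.
Qed.

(** The integers are split according to whether p divides them. *)
Lemma smooth_sum_cons (R : realFieldType) (l : seq nat) (p u : nat) (F : nat -> R) :
  prime p -> p \notin l ->
  smooth_sum (p :: l) u F =
  smooth_sum l u F + smooth_sum (p :: l) (u %/ p) (fun m => F (p * m)%N).
Proof.
move=> pp pl; have p0 := prime_gt0 pp.
rewrite /smooth_sum (bigID (fun n => p %| n)%N) /= addrC; congr (_ + _).
  rewrite big_nat_cond [RHS]big_nat_cond; apply: eq_bigl => n.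
  case n0: (0 < n)%N => //=; case: (n < u.+1)%N => //=.
  exact: smooth_cons_coprime.
under eq_bigl do rewrite andbC.
(* The multiples of p up to u are the p m with m <= u / p. *)
rewrite -big_filter_cond.
have -> : \sum_(i <- [seq i <- index_iota 1 u.+1 | (p %| i)%N] |
     all (mem (p :: l)) (primes i)) F i =
   \sum_(i <- [seq (p * m)%N | m <- index_iota 1 (u %/ p).+1] |
     all (mem (p :: l)) (primes i)) F i.
  apply: perm_big; apply: uniq_perm.
  - by rewrite filter_uniq ?iota_uniq.
  - rewrite map_inj_uniq ?iota_uniq // => m n /eqP.
    by rewrite eqn_pmul2l // => /eqP.
  move=> n; rewrite mem_filter mem_index_iota; apply/idP/mapP.
    move=> /andP[/dvdnP[m ->] /andP[n0 nu]]; exists m; last by rewrite mulnC.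
    rewrite mem_index_iota ltnS leq_divRL //; rewrite ltnS in nu; rewrite nu andbT.
    by move: n0; rewrite muln_gt0 => /andP[].
  move=> [m]; rewrite mem_index_iota ltnS => /andP[m0 mu] ->.
  by rewrite dvdn_mulr //= muln_gt0 p0 m0 ltnS mulnC -leq_divRL.
rewrite big_map big_nat_cond [RHS]big_nat_cond; apply: eq_bigl => n.
case n0: (0 < n)%N => //=; case: (n < _)%N => //=.
exact: smooth_cons_mul.
Qed.

Lemma smooth_sum_ge0 (R : realFieldType) (l : seq nat) (u : nat) (F : nat -> R) :
  (forall n, 0 <= F n) -> 0 <= smooth_sum l u F.
Proof. by move=> F0; apply: sumr_ge0. Qed.

Lemma smooth_sum_le (R : realFieldType) (l : seq nat) (u v : nat) (F : nat -> R) :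
  (forall n, 0 <= F n) -> (u <= v)%N -> smooth_sum l u F <= smooth_sum l v F.
Proof.
move=> F0 uv; rewrite /smooth_sum [leRHS](@big_cat_nat _ _ _ u.+1) //=.
by rewrite lerDl sumr_ge0.
Qed.

Lemma smooth_sumZ (R : realFieldType) (l : seq nat) (u : nat) (c : R) (F : nat -> R) :
  smooth_sum l u (fun n => c * F n) = c * smooth_sum l u F.
Proof. by rewrite /smooth_sum mulr_sumr. Qed.

Lemma eq_smooth_sum (R : realFieldType) (l : seq nat) (u : nat) (F G : nat -> R) :
  (forall n, (0 < n)%N -> F n = G n) -> smooth_sum l u F = smooth_sum l u G.
Proof.
move=> FG; rewrite /smooth_sum big_nat_cond [RHS]big_nat_cond.
by apply: eq_bigr => n /andP[/andP[n0 _] _]; apply: FG.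
Qed.

Definition smooth_harmonic (R : realFieldType) (l : seq nat) (u : nat) : R :=
  smooth_sum l u (fun n => n%:R^-1).

Definition smooth_sieve_sum (R : realFieldType) (h : nat -> R) (l : seq nat) (u : nat) : R :=
  smooth_sum l u (fun d => (squarefree d)%:R * primeprod h d).

Lemma smooth_harmonic_ge0 (R : realFieldType) (l : seq nat) (u : nat) :
  0 <= smooth_harmonic R l u.
Proof. by apply: smooth_sum_ge0 => n; rewrite invr_ge0. Qed.

Lemma smooth_harmonic_mono (R : realFieldType) (l : seq nat) (u v : nat) :
  (u <= v)%N -> smooth_harmonic R l u <= smooth_harmonic R l v.
Proof. by apply: smooth_sum_le => n; rewrite invr_ge0. Qed.

Lemma smooth_harmonic_cons (R : realFieldType) (l : seq nat) (p u : nat) :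
  prime p -> p \notin l ->
  smooth_harmonic R (p :: l) u =
  smooth_harmonic R l u + p%:R^-1 * smooth_harmonic R (p :: l) (u %/ p).
Proof.
move=> pp pl; rewrite /smooth_harmonic smooth_sum_cons // -smooth_sumZ.
by congr (_ + _); apply: eq_smooth_sum => n _; rewrite natrM invfM.
Qed.

Lemma squarefree_mul (p d : nat) : prime p -> (0 < d)%N ->
  squarefree (p * d) = ~~ (p %| d)%N && squarefree d.
Proof.
move=> pp d0; have p0 := prime_gt0 pp; rewrite /squarefree.
have [pd|pd] := boolP (p %| d)%N.
  apply/negbTE; rewrite neq_ltn; apply/orP; right.
  apply: (@leq_ltn_trans d); last by rewrite ltn_Pmull ?prime_gt1.
  have -> : primes (p * d) = primes d.
    apply/eq_primes => q; rewrite primesM // primes_prime // inE.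
    by case: eqP => [->|//]; rewrite mem_primes pp d0 pd.
  by rewrite dvdn_leq // prod_primes_dvd.
rewrite (perm_big (p :: primes d)); first by rewrite big_cons eqn_pmul2l.
apply: uniq_perm; rewrite ?primes_uniq //=.
  by rewrite primes_uniq andbT mem_primes (negbTE pd) !andbF.
by move=> q; rewrite primesM // primes_prime // !inE.
Qed.

Lemma primeprod_mul_prime (R : realFieldType) (h : nat -> R) (p d : nat) :
  prime p -> (0 < d)%N -> ~~ (p %| d)%N ->
  primeprod h (p * d) = h p * primeprod h d.
Proof.
move=> pp d0 pd; have p0 := prime_gt0 pp.
rewrite /primeprod (perm_big (p :: primes d)); first by rewrite big_cons.
apply: uniq_perm; rewrite ?primes_uniq //=.
  by rewrite primes_uniq andbT mem_primes (negbTE pd) !andbF.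
by move=> q; rewrite primesM // primes_prime // !inE.
Qed.

(** When p d is squarefree, d is prime to p, so that p appears at most once,
    in contrast with [smooth_harmonic_cons]. *)
Lemma smooth_sieve_sum_cons (R : realFieldType) (h : nat -> R) (l : seq nat) (p u : nat) :
  prime p -> p \notin l ->
  smooth_sieve_sum h (p :: l) u =
  smooth_sieve_sum h l u + h p * smooth_sieve_sum h l (u %/ p).
Proof.
move=> pp pl; rewrite /smooth_sieve_sum smooth_sum_cons //; congr (_ + _).
rewrite -smooth_sumZ /smooth_sum [LHS]big_mkcond [RHS]big_mkcond.
apply: eq_big_nat => n /andP[n0 _] /=.
rewrite -(smooth_cons_coprime pp pl n0) squarefree_mul //.
have [pn|pn] := boolP (p %| n)%N; first by rewrite andbF mul0r if_same.
by rewrite andbT primeprod_mul_prime // mulrCA.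
Qed.

Lemma primeprod_ge0 (R : realFieldType) (h : nat -> R) (d : nat) :
  (forall p, prime p -> 0 <= h p) -> 0 <= primeprod h d.
Proof.
move=> h0; rewrite /primeprod big_seq; apply: prodr_ge0 => p.
by rewrite mem_primes => /and3P[/h0].
Qed.

Lemma smooth_sieve_sum_ge0 (R : realFieldType) (h : nat -> R) (l : seq nat) (u : nat) :
  (forall p, prime p -> 0 <= h p) -> 0 <= smooth_sieve_sum h l u.
Proof.
by move=> h0; apply: smooth_sum_ge0 => n; rewrite mulr_ge0 ?primeprod_ge0.
Qed.

Lemma smooth_sieve_sum_le (R : realFieldType) (h : nat -> R) (l : seq nat) (u v : nat) :
  (forall p, prime p -> 0 <= h p) -> (u <= v)%N ->
  smooth_sieve_sum h l u <= smooth_sieve_sum h l v.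
Proof.
move=> h0 uv; apply: smooth_sum_le => // n.
by rewrite mulr_ge0 ?primeprod_ge0.
Qed.

(** Iterating [smooth_harmonic_cons] multiplies the sum by at most
    1 + 1/p + 1/p^2 + ... <= 2. *)
Lemma smooth_harmonic_le2 (R : realFieldType) (l : seq nat) (p u : nat) :
  prime p -> p \notin l ->
  smooth_harmonic R (p :: l) u <= 2 * smooth_harmonic R l u.
Proof.
move=> pp pl; have p1 := prime_gt1 pp; elim/ltn_ind: u => u IH.
have H0 := smooth_harmonic_ge0 R l.
have [->|u0] := posnP u.
  by rewrite /smooth_harmonic /smooth_sum !big_geq // mulr0.
rewrite smooth_harmonic_cons //.
have lt : (u %/ p < u)%N by rewrite ltn_Pdiv.
have := IH _ lt.
have le : smooth_harmonic R l (u %/ p) <= smooth_harmonic R l u.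
  by apply: smooth_harmonic_mono; exact: ltnW.
have p2 : p%:R^-1 <= 2^-1 :> R by rewrite lef_pV2 ?posrE ?ltr0n ?prime_gt0 // ler_nat.
move=> h; have : p%:R^-1 * smooth_harmonic R (p :: l) (u %/ p) <=
   2^-1 * (2 * smooth_harmonic R l u).
  by rewrite ler_pM ?invr_ge0 ?smooth_harmonic_ge0 //; lra.
by lra.
Qed.

(** When p is adjoined to l, the terms of the harmonic sum with p | n but not
    p^2 | n are matched by the new terms of the sieve sum, since 1/p is f p up to
    K/p^2; those with p^2 | n contribute at most 2/p^2 times the old sum by
    [smooth_harmonic_le2]. *)
Lemma smooth_harmonic_le (R : realFieldType) (f : nat -> R) (K : R) (l : seq nat) (u : nat) :
  0 <= K -> (forall p, prime p -> 0 <= f p) ->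
  (forall p, prime p -> p%:R^-1 <= f p + K / p%:R ^+ 2) ->
  uniq l -> all prime l ->
  smooth_harmonic R l u <=
    \prod_(p <- l) (1 + (K + 2) / p%:R ^+ 2) * smooth_sieve_sum f l u.
Proof.
move=> K0 f0 fK; elim: l u => [|p l IH] u /=.
  rewrite big_nil mul1r /smooth_harmonic /smooth_sieve_sum !smooth_sum_nil.
  by rewrite /squarefree /primeprod !big_nil eqxx invr1 !mulr1.
move=> /andP[pl ul] /andP[pp al]; rewrite big_cons.
set C := \prod_(q <- l) _ in IH *.
have {IH} IH v : smooth_harmonic R l v <= C * smooth_sieve_sum f l v by apply: IH.
have C0 : 0 <= C.
  by apply: prodr_ge0 => q _; rewrite addr_ge0 // divr_ge0 ?sqr_ge0 // addr_ge0.
have p0 : (0 : R) < p%:R by rewrite ltr0n prime_gt0.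
have W0 v : 0 <= smooth_sieve_sum f l v by apply: smooth_sieve_sum_ge0.
set s : R := p%:R^-1; have s0 : 0 <= s by rewrite invr_ge0 ltW.
have fs : s <= f p + K * s ^+ 2 by rewrite exprVn; apply: fK.
rewrite smooth_sieve_sum_cons // -exprVn -/s.
have e1 : smooth_harmonic R (p :: l) u <= smooth_harmonic R l u +
    s * (smooth_harmonic R l (u %/ p) + s * (2 * smooth_harmonic R l u)).
  rewrite smooth_harmonic_cons // lerD2l ler_wpM2l //.
  rewrite smooth_harmonic_cons // lerD2l ler_wpM2l //.
  apply: le_trans (smooth_harmonic_le2 _ _ pp pl) _; rewrite ler_wpM2l //.
  by apply: smooth_harmonic_mono; rewrite (leq_trans (leq_div _ _)) ?leq_div.
apply: le_trans e1 _.
(* The terms correspond to the exponent of p in n: 0, 1, or at least 2. *)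
have i1 := IH u; have i2 := IH (u %/ p)%N.
set a := smooth_sieve_sum f l u in i1 *; set b := smooth_sieve_sum f l (u %/ p) in i2 *.
have ba : b <= a by apply: smooth_sieve_sum_le => //; apply: leq_div.
have a0 : 0 <= a by apply: W0.
have b0 : 0 <= b by apply: W0.
have fp0 := f0 p pp.
apply: (@le_trans _ _ (C * a + s * (C * b + s * (2 * (C * a))))).
  by rewrite lerD // ler_wpM2l // lerD // ler_wpM2l // ler_wpM2l.
have -> : C * a + s * (C * b + s * (2 * (C * a))) =
   C * ((1 + 2 * s ^+ 2) * a + s * b) by ring.
rewrite -[leRHS]mulrA [leRHS]mulrCA ler_wpM2l //.
have h1 : s * b <= (f p + K * s ^+ 2) * b by rewrite ler_wpM2r.
have h2 : K * s ^+ 2 * b <= K * s ^+ 2 * a by rewrite ler_wpM2l // mulr_ge0 ?sqr_ge0.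
have h3 : 0 <= (K + 2) * s ^+ 2 * (f p * b).
  by rewrite !mulr_ge0 ?sqr_ge0 ?addr_ge0.
by lra.
Qed.

(** Doubling the dimension of the sieve: in the product of two sums, an
    integer a b with a and b coprime and squarefree arises 2^omega(a b) times,
    which the weight 2 f absorbs; a prime dividing both a and b costs only
    f p ^+ 2. *)
Lemma smooth_sieve_sum_sqr (R : realFieldType) (f : nat -> R) (l : seq nat) (u v : nat) :
  (forall p, prime p -> 0 <= f p) -> uniq l -> all prime l ->
  smooth_sieve_sum f l u * smooth_sieve_sum f l v <=
    \prod_(p <- l) (1 + f p ^+ 2) * smooth_sieve_sum (fun p => 2 * f p) l (u * v).
Proof.
move=> f0; elim: l u v => [|p l IH] u v /=.
  rewrite big_nil mul1r /smooth_sieve_sum !smooth_sum_nil.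
  rewrite /squarefree /primeprod !big_nil eqxx !mulr1 muln_gt0.
  by case: (0 < u)%N; case: (0 < v)%N; rewrite /= ?mulr1 ?mulr0 ?mul0r.
move=> /andP[pl ul] /andP[pp al]; rewrite big_cons !smooth_sieve_sum_cons //.
set C := \prod_(q <- l) _ in IH *.
have {IH} IH a b : smooth_sieve_sum f l a * smooth_sieve_sum f l b <=
  C * smooth_sieve_sum (fun p => 2 * f p) l (a * b) by apply: IH.
have C0 : 0 <= C by apply: prodr_ge0 => q _; rewrite addr_ge0 ?sqr_ge0.
have g0 q : prime q -> 0 <= 2 * f q by move=> /f0 ?; rewrite mulr_ge0.
have fp0 := f0 p pp.
pose W n := smooth_sieve_sum (fun p => 2 * f p) l n.
have Wle a b : (a <= b)%N -> W a <= W b by apply: smooth_sieve_sum_le.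
have W0 n : 0 <= W n by apply: smooth_sieve_sum_ge0.
have i1 := IH u v.
have i2 : smooth_sieve_sum f l (u %/ p) * smooth_sieve_sum f l v <=
    C * W (u * v %/ p)%N.
  apply: le_trans (IH _ _) _; rewrite ler_wpM2l // Wle //.
  by rewrite leq_divRL ?prime_gt0 // mulnAC leq_mul2r leq_divM orbT.
have i3 : smooth_sieve_sum f l u * smooth_sieve_sum f l (v %/ p) <=
    C * W (u * v %/ p)%N.
  apply: le_trans (IH _ _) _; rewrite ler_wpM2l // Wle //.
  by rewrite leq_divRL ?prime_gt0 // -mulnA leq_mul2l leq_divM orbT.
have i4 : smooth_sieve_sum f l (u %/ p) * smooth_sieve_sum f l (v %/ p) <=
    C * W (u * v)%N.
  by apply: le_trans (IH _ _) _; rewrite ler_wpM2l // Wle // leq_mul ?leq_div.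
rewrite -/(W _) -/(W _).
set a := smooth_sieve_sum f l u in i1 i3 *; set b := smooth_sieve_sum f l v in i1 i2 *.
set a' := smooth_sieve_sum f l _ in i2 i4 *; set b' := smooth_sieve_sum f l _ in i3 i4 *.
rewrite -/(W _) in i1; set w := W (u * v)%N in i1 i4 *; set w' := W _ in i2 i3 *.
have -> : (a + f p * a') * (b + f p * b') =
  a * b + f p * (a' * b + a * b') + f p ^+ 2 * (a' * b') by ring.
apply: (@le_trans _ _ (C * w + f p * (C * w' + C * w') + f p ^+ 2 * (C * w))).
  by rewrite lerD ?ler_wpM2l ?sqr_ge0 // lerD // ler_wpM2l // lerD.
have : 0 <= f p ^+ 2 * C * (2 * f p * w').
  by rewrite !mulr_ge0 ?sqr_ge0 // /w' W0.
by lra.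
Qed.

Lemma smooth_sieve_sum_mono (R : realFieldType) (f h : nat -> R) (l : seq nat) (u : nat) :
  (forall p, prime p -> 0 <= f p <= h p) ->
  smooth_sieve_sum f l u <= smooth_sieve_sum h l u.
Proof.
move=> fh; apply: ler_sum => d _; rewrite ler_wpM2l //.
rewrite /primeprod big_seq [leRHS]big_seq; apply: ler_prod => p.
by rewrite mem_primes => /and3P[/fh].
Qed.

Definition primes_upto (z : nat) : seq nat := [seq p <- iota 0 z.+1 | prime p].

Lemma mem_primes_upto (z p : nat) : (p \in primes_upto z) = prime p && (p <= z)%N.
Proof. by rewrite mem_filter mem_iota ltnS. Qed.

Lemma smooth_sum_upto (R : realFieldType) (u z : nat) (F : nat -> R) : (u <= z)%N ->
  smooth_sum (primes_upto z) u F = \sum_(1 <= n < u.+1) F n.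
Proof.
move=> uz; rewrite /smooth_sum big_mkcond; apply: eq_big_nat => n /andP[n0 nu].
rewrite ifT //; apply/allP => p; rewrite mem_primes => /and3P[pp _ pn].
rewrite /= mem_primes_upto pp (leq_trans (dvdn_leq n0 pn)) //.
by apply: leq_trans uz; rewrite -ltnS.
Qed.

(** Every integer up to m is smooth with respect to the primes up to m^2, so the
    left-hand side is the square of a full harmonic sum. *)
Lemma sieve_sum_ge_harmonic (R : realFieldType) (f h : nat -> R) (K : R) (m : nat) :
  0 <= K -> (0 < m)%N -> (forall p, prime p -> 0 <= f p) ->
  (forall p, prime p -> p%:R^-1 <= f p + K / p%:R ^+ 2) ->
  (forall p, prime p -> 2 * f p <= h p) ->
  (\sum_(1 <= n < m.+1) n%:R^-1) ^+ 2 <=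
   (\prod_(p <- primes_upto (m ^ 2)) (1 + (K + 2) / p%:R ^+ 2)) ^+ 2 *
   (\prod_(p <- primes_upto (m ^ 2)) (1 + f p ^+ 2)) * sieve_sum h (m ^ 2).
Proof.
move=> K0 m0 f0 fK fh; set l := primes_upto _; set C := \prod_(p <- l) _.
have lu : uniq l by rewrite filter_uniq ?iota_uniq.
have lp : all prime l by rewrite filter_all.
have lem : (m <= m ^ 2)%N by rewrite -{1}[m]expn1 leq_pexp2l.
have -> : sieve_sum h (m ^ 2) = smooth_sieve_sum h l (m ^ 2).
  rewrite /smooth_sieve_sum smooth_sum_upto // /sieve_sum big_mkcond.
  by apply: eq_bigr => d _; case: (squarefree d); rewrite ?mul1r ?mul0r.
rewrite -(smooth_sum_upto _ lem) -/l -/(smooth_harmonic R l m).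
have C0 : 0 <= C.
  by apply: prodr_ge0 => q _; rewrite addr_ge0 // divr_ge0 ?sqr_ge0 // addr_ge0.
have H0 := smooth_harmonic_ge0 R l m.
have h1 := smooth_harmonic_le m K0 f0 fK lu lp.
have h2 := smooth_sieve_sum_sqr m m f0 lu lp.
apply: (@le_trans _ _ ((C * smooth_sieve_sum f l m) ^+ 2)).
  by rewrite lerXn2r // nnegrE // mulr_ge0 // smooth_sieve_sum_ge0.
rewrite exprMn -mulrA ler_wpM2l ?sqr_ge0 // expr2; apply: le_trans h2 _.
rewrite -mulnn ler_wpM2l //.
  by apply: prodr_ge0 => q _; rewrite addr_ge0 ?sqr_ge0.
by apply: smooth_sieve_sum_mono => p pp; rewrite mulr_ge0 ?f0 ?fh.
Qed.

(** * Chebyshev's lower bound and logarithmic estimates *)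

Lemma exp2_le_central_bin (n : nat) : (2 ^ n <= 'C(n.*2, n))%N.
Proof.
elim: n => [//|n IH]; rewrite doubleS expnS mul2n -addnn binS.
have le : ('C(n.*2, n) <= 'C(n.*2.+1, n))%N.
  by case: n {IH} => [|n] //; rewrite [leqRHS]binS leq_addr.
apply: leq_add; first by apply: leq_trans IH _; rewrite binS leq_addl.
exact: leq_trans IH le.
Qed.

(** By Legendre's formula the exponent of p is the sum over k of
    (2n %/ p^k) - 2 (n %/ p^k), where each term is at most 1 and the terms with
    2n < p^k vanish. *)
Lemma prime_power_central_bin (p n : nat) :
  prime p -> (0 < n)%N -> (p ^ logn p 'C(n.*2, n) <= n.*2)%N.
Proof.
move=> pp n0; have p1 := prime_gt1 pp; have n20 : (0 < n.*2)%N by rewrite double_gt0.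
apply: leq_trans (trunc_logP p1 n20); rewrite leq_pexp2l ?prime_gt0 //.
set t := trunc_log p n.*2.
have e : (logn p (n.*2)`! = logn p 'C(n.*2, n) + 2 * logn p n`!)%N.
  rewrite -[n.*2]addnn -(bin_fact (leq_addr n n)) addnK.
  by rewrite !lognM ?muln_gt0 ?fact_gt0 ?bin_gt0 ?leq_addr // mul2n -addnn.
have e2 : (logn p n`! = \sum_(1 <= k < n.*2.+1) n %/ p ^ k)%N.
  rewrite logn_fact // (@big_cat_nat _ _ _ n.+1 1 n.*2.+1) //=; last first.
    by rewrite ltnS -addnn leq_addr.
  rewrite [X in (_ = _ + X)%N]big_nat_cond [X in (_ = _ + X)%N]big1 ?addn0 //.
  move=> k /andP[/andP[nk _] _]; apply: divn_small; apply: leq_trans nk _.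
  exact: ltnW (ltn_expl _ p1).
have : (logn p (n.*2)`! <= t + 2 * logn p n`!)%N.
  rewrite e2 logn_fact // big_distrr /=.
  apply: (@leq_trans (\sum_(1 <= k < n.*2.+1) ((k <= t) + 2 * (n %/ p ^ k)))).
    rewrite big_nat_cond [leqRHS]big_nat_cond; apply: leq_sum => k /andP[/andP[k0 _] _].
    have pk0 : (0 < p ^ k)%N by rewrite expn_gt0 prime_gt0.
    have [kt|tk] := leqP k t.
      rewrite -ltnS -addSn -[2%N]/(1 + 1)%N.
      rewrite ltn_divLR //= -mulnS -mulnA mul2n ltn_double.
      exact: ltn_ceil.
    rewrite divn_small // ltnNge; apply: contraL tk => /(trunc_log_max p1).
    by rewrite -leqNgt.
  rewrite big_split leq_add2r /= -/t.
  elim: n.*2 => [|M IH]; first by rewrite big_geq.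
  rewrite big_nat_recr //=; case: (leqP M.+1 t) => [Mt|_] /=; last by rewrite addn0 /=.
  apply: leq_trans Mt; rewrite addn1 ltnS.
  apply: (@leq_trans (\sum_(1 <= k < M.+1) 1)); first by apply: leq_sum => k _; apply: leq_b1.
  by rewrite sum_nat_const_nat muln1 subSS subn0.
by rewrite e leq_add2r.
Qed.

Lemma primes_upto_ge (n : nat) : (0 < n)%N ->
  (2 ^ n <= n.*2 ^ size (primes_upto n.*2))%N.
Proof.
move=> n0; apply: leq_trans (exp2_le_central_bin n) _.
have c0 : (0 < 'C(n.*2, n))%N by rewrite bin_gt0 -addnn leq_addr.
have n20 : (0 < n.*2)%N by rewrite double_gt0.
set c := 'C(_, _) in c0 *.
rewrite {1}(prod_prime_decomp c0) prime_decompE big_map /=.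
apply: (@leq_trans (\prod_(p <- primes c) n.*2)).
  rewrite big_seq [leqRHS]big_seq; apply: leq_prod => p.
  by rewrite mem_primes => /and3P[pp _ _]; apply: prime_power_central_bin.
rewrite big_const_seq count_predT iter_muln_1 leq_pexp2l //.
apply: uniq_leq_size; first exact: primes_uniq.
move=> p pc; rewrite mem_primes_upto; move: (pc).
rewrite mem_primes => /and3P[pp _ _]; rewrite pp /=.
apply: leq_trans (prime_power_central_bin pp n0).
have l0 : (0 < logn p c)%N by rewrite logn_gt0.
by apply: leq_trans (leq_pexp2l (prime_gt0 pp) l0); rewrite expn1.
Qed.

(** Telescoping: 1/(n+1)^2 <= 1/n - 1/(n+1). *)
Lemma sum_inv_sqr_le2 (R : realType) (z : nat) :
  \sum_(1 <= n < z.+1) (n%:R ^+ 2)^-1 <= 2 :> R.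
Proof.
case: z => [|z]; first by rewrite big_geq.
have H : \sum_(1 <= n < z.+2) (n%:R ^+ 2)^-1 <= 2 - z.+1%:R^-1 :> R.
  elim: z => [|z IH]; first by rewrite big_nat1 expr1n invr1; lra.
  rewrite big_nat_recr //=; apply: le_trans (lerD IH (lexx _)) _.
  have z1 : (0 : R) < z.+1%:R by rewrite ltr0n.
  rewrite -[z.+2]addn1 natrD; set a := z.+1%:R in z1 *.
  have a1 : 0 < a + 1 by lra.
  rewrite -subr_ge0.
  have -> : 2 - (a + 1)^-1 - (2 - a^-1 + ((a + 1) ^+ 2)^-1) =
     (a * (a + 1) ^+ 2)^-1 by field; rewrite !gt_eqF.
  by rewrite invr_ge0 mulr_ge0 ?sqr_ge0 // ltW.
by apply: le_trans H _; rewrite lerBlDr lerDl invr_ge0 ler0n.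
Qed.

Lemma prod_primes_le_expR (R : realType) (c : R) (z : nat) : 0 <= c ->
  \prod_(p <- primes_upto z) (1 + c / p%:R ^+ 2) <= expR (2 * c).
Proof.
move=> c0.
apply: (@le_trans _ _ (\prod_(p <- primes_upto z) expR (c / p%:R ^+ 2))).
  by apply: ler_prod => p _; rewrite expR_ge1Dx addr_ge0 // divr_ge0 ?sqr_ge0.
rewrite -(big_morph _ (@expRD R) (@expR0 R)) ler_expR -mulr_sumr mulrC.
rewrite ler_wpM2r //; apply: le_trans (sum_inv_sqr_le2 R z).
rewrite big_filter big_mkcond -[iota 0 z.+1]/(0 :: iota 1 z) big_cons /= add0r.
rewrite /index_iota subSS subn0; apply: ler_sum => p _.
by case: ifP => // _; rewrite invr_ge0 sqr_ge0.
Qed.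

Lemma ln_le_harmonic (R : realType) (m : nat) :
  ln m.+1%:R <= \sum_(1 <= n < m.+1) n%:R^-1 :> R.
Proof.
elim: m => [|m IH]; first by rewrite ln1 big_geq.
rewrite big_nat_recr //=; apply: le_trans (lerD IH (lexx _)).
have m0 : (0 : R) < m.+1%:R by rewrite ltr0n.
have -> : m.+2%:R = m.+1%:R * (1 + m.+1%:R^-1) :> R.
  by rewrite -[m.+2]addn1 natrD; field; rewrite gt_eqF.
have i0 : (0 : R) < m.+1%:R^-1 by rewrite invr_gt0.
rewrite lnM ?posrE ?addr_gt0 //.
by rewrite lerD2l le_ln1Dx // (lt_trans _ i0) // ltrN10.
Qed.

(** The comparison function f is 1/(p + k) for p > p0, and 0 for the finitely
    many primes that are not sieved; the constant K = k + p0^2 covers the defect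
    1/p - f p in both cases. *)
Lemma sieve_sum_ge_ln2 (R : realType) (k p0 : nat) :
  exists2 kappa : R, 0 < kappa & forall (h : nat -> R) (m : nat), (0 < m)%N ->
    (forall p, prime p ->
       2 * (if (p <= p0)%N then 0 else (p + k)%:R^-1) <= h p) ->
    kappa * ln m%:R ^+ 2 <= sieve_sum h (m ^ 2).
Proof.
pose K : R := (k + p0 ^ 2)%:R.
pose f (p : nat) : R := if (p <= p0)%N then 0 else (p + k)%:R^-1.
pose C := expR (2 * (K + 2)) ^+ 2 * expR (2 * 1).
have C0 : 0 < C by rewrite mulr_gt0 ?exprn_gt0 ?expR_gt0.
exists C^-1; first by rewrite invr_gt0.
move=> h m m0 fh.
have K0 : 0 <= K by rewrite ler0n.
have f0 p : 0 <= f p by rewrite /f; case: ifP.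
have fp p : prime p -> f p ^+ 2 <= 1 / p%:R ^+ 2.
  move=> pp; rewrite div1r -exprVn lerXn2r ?nnegrE ?invr_ge0 //.
  rewrite /f; case: ifP => _; first by rewrite invr_ge0.
  rewrite lef_pV2 ?posrE ?ltr0n ?addn_gt0 ?(prime_gt0 pp) //.
  by rewrite ler_nat leq_addr.
have fK p : prime p -> p%:R^-1 <= f p + K / p%:R ^+ 2.
  move=> pp; have pR : (0 : R) < p%:R by rewrite ltr0n prime_gt0.
  have K1 (c : nat) : (c <= k + p0 ^ 2)%N -> c%:R / p%:R ^+ 2 <= K / p%:R ^+ 2 :> R.
    by move=> cK; rewrite ler_wpM2r ?invr_ge0 ?sqr_ge0 // ler_nat.
  rewrite /f; case: leqP => pp0.
    rewrite add0r; apply: le_trans (K1 p _).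
      by rewrite expr2 invfM mulrA mulfV ?mul1r // gt_eqF.
    have p00 := leq_trans (prime_gt0 pp) pp0.
    apply: leq_trans pp0 _; apply: leq_trans _ (leq_addl _ _).
    by rewrite -mulnn leq_pmull.
  apply: le_trans (lerD (lexx _) (K1 k (leq_addr _ _))).
  have kR : (0 : R) <= k%:R by rewrite ler0n.
  have pk : (0 : R) < p%:R + k%:R by lra.
  rewrite natrD -subr_ge0.
  have -> : (p%:R + k%:R)^-1 + k%:R / p%:R ^+ 2 - p%:R^-1 =
     k%:R ^+ 2 / ((p%:R + k%:R) * p%:R ^+ 2) :> R.
    by field; rewrite !gt_eqF.
  by rewrite divr_ge0 ?sqr_ge0 ?mulr_ge0 ?sqr_ge0 // ltW.
have main := sieve_sum_ge_harmonic K0 m0 (fun p _ => f0 p) fK fh.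
have L0 : 0 <= sieve_sum h (m ^ 2).
  apply: sumr_ge0 => d _; apply: primeprod_ge0 => p pp.
  by apply: le_trans (fh p pp); rewrite mulr_ge0 ?f0.
rewrite mulrC ler_pdivrMr //.
have lnm : (0 : R) <= ln m%:R by rewrite ln_ge0 // ler1n.
apply: (@le_trans _ _ ((\sum_(1 <= n < m.+1) n%:R^-1) ^+ 2)).
  rewrite lerXn2r ?nnegrE //.
    by apply: sumr_ge0 => n _; rewrite invr_ge0.
  apply: le_trans (ln_le_harmonic R m).
  by rewrite ler_ln ?posrE ?ltr0n // ler_nat.
apply: le_trans main _; rewrite [leRHS]mulrC ler_wpM2r //.
have P0 : 0 <= \prod_(p <- primes_upto (m ^ 2)) (1 + (K + 2) / p%:R ^+ 2).
  by apply: prodr_ge0 => q _; rewrite addr_ge0 // divr_ge0 ?sqr_ge0 // addr_ge0.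
rewrite ler_pM ?sqr_ge0 //.
- by apply: prodr_ge0 => q _; rewrite addr_ge0 ?sqr_ge0.
- rewrite lerXn2r ?nnegrE ?expR_ge0 //.
  by apply: prod_primes_le_expR; rewrite addr_ge0.
apply: le_trans (prod_primes_le_expR (m ^ 2) ler01).
rewrite big_seq [leRHS]big_seq; apply: ler_prod => p.
rewrite mem_primes_upto => /andP[pp _].
by rewrite addr_ge0 ?sqr_ge0 //= lerD2l fp.
Qed.

Lemma ln2_ge_half (R : realType) : 2^-1 <= ln 2 :> R.
Proof.
have : ln (1 + (- 2^-1)) <= - 2^-1 :> R by apply: le_ln1Dx; lra.
have -> : 1 + (- 2^-1) = 2^-1 :> R by lra.
by rewrite lnV ?posrE // lerN2.
Qed.

(** 2^n <= C(2n, n), and each of the prime powers whose product is C(2n, n) is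
    at most 2n. *)
Lemma chebyshev_lower (R : realType) (n : nat) : (0 < n)%N ->
  n%:R / 2 <= (size (primes_upto n.*2))%:R * ln n.*2%:R :> R.
Proof.
move=> n0; have := primes_upto_ge n0; rewrite -(ler_nat R) !natrX => H.
have n2 : (0 : R) < n.*2%:R by rewrite ltr0n double_gt0.
rewrite -ler_ln ?posrE ?exprn_gt0 // !lnXn // in H.
rewrite -[leLHS]mulr_natl -[leRHS]mulr_natl in H.
by apply: le_trans H; rewrite ler_wpM2l ?ler0n // ln2_ge_half.
Qed.

(** * Densities of the residue classes removed by a prime *)

Lemma horner_periodic_mod (P : {poly int}) (p i : nat) :
  (P.[(i + p)%N%:Z] = P.[i%:Z] %[mod p%:Z])%Z.
Proof.
apply/eqP; rewrite eqz_mod_dvd.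
have /factor_theorem [Q] : root (P - (P.[i%:Z])%:P) i%:Z.
  by rewrite rootE !hornerE subrr.
move=> /(congr1 (horner^~ (i + p)%N%:Z)); rewrite !hornerE => ->.
by rewrite PoszD [i%:Z + _]addrC addrK dvdz_mull ?dvdzz.
Qed.

Definition hits (P : {poly int}) (p n j : nat) : bool := (p%:Z %| n%:Z - P.[j%:Z])%Z.

Lemma hitsE P p n j : hits P p n j = (n%:Z == P.[j%:Z] %[mod p%:Z])%Z.
Proof. by rewrite eqz_mod_dvd. Qed.

Lemma hits_periodic P p n j :
  hits P p (n + p) j = hits P p n j /\ hits P p n (j + p) = hits P p n j.
Proof.
rewrite !hitsE horner_periodic_mod; split=> //; congr (_ == _).
by rewrite PoszD modzDr.
Qed.

Lemma mean_hits (R : realFieldType) P p j : (0 < p)%N ->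
  mean p (fun n => (hits P p n j)%:R) = p%:R^-1 :> R.
Proof.
move=> p0; have pz : p%:Z != 0 by case: p p0.
rewrite /mean -[RHS]mul1r; congr (_ / _).
have vp : (`|(P.[j%:Z] %% p%:Z)%Z| < p)%N.
  by rewrite -ltz_nat gez0_abs ?modz_ge0 // ltz_pmod.
rewrite big_mkord (bigD1 (Ordinal vp)) //= big1 ?addr0.
  by rewrite hitsE gez0_abs ?modz_ge0 // modz_mod eqxx.
move=> n /eqP nv; case h: (hits _ _ _ _) => //; case: nv; apply/val_inj => /=.
by move: h; rewrite hitsE modz_nat modn_small // => /eqP <-.
Qed.

(** A nonzero polynomial of degree k over the field with p elements has at most
    k roots; here the leading coefficient does not vanish modulo p. *)
Lemma count_roots_modp (P : {poly int}) (k p : nat) (c : int) :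
  prime p -> (0 < k)%N -> size P = k.+1 -> ~~ (p %| absz (P`_k)%R)%N ->
  (count (fun j => (p%:Z %| (c - P.[j%:Z])%R)%Z) (iota 0 p) <= k)%N.
Proof.
move=> pp k0 sP pk; rewrite -size_filter; set s := [seq _ <- _ | _].
have ch := pchar_Fp pp.
pose Q : {poly 'F_p} := map_poly intr (P - c%:P).
have sPc : (size (P - c%:P)%R <= k.+1)%N.
  apply: leq_trans (size_polyD _ _) _.
  by rewrite size_polyN geq_max sP leqnn (leq_trans (size_polyC_leq1 _)).
have Qk : Q`_k != 0.
  rewrite coef_map /= coefB coefC gtn_eqF // subr0 -(dvdz_pcharf ch).
  by rewrite dvdzE.
have Q0 : Q != 0 by apply: contraNneq Qk => ->; rewrite coef0.
rewrite -(size_map (fun j => j%:R : 'F_p)) -ltnS.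
have sQ : (size Q <= k.+1)%N by apply: leq_trans (size_poly _ _) sPc.
apply: leq_trans sQ; apply: max_poly_roots => //.
  apply/allP => x /mapP[j]; rewrite mem_filter => /andP[pj _] ->.
  rewrite rootE -[j%:R]/(j%:Z%:~R) horner_map /= -(dvdz_pcharf ch).
  by rewrite !hornerE -opprB rpredN.
rewrite map_inj_in_uniq ?filter_uniq ?iota_uniq // => i j.
rewrite !mem_filter !mem_iota /= add0n => /andP[_ ip] /andP[_ jp] /eqP.
rewrite -subr_eq0 -[i%:R]/(i%:Z%:~R) -[j%:R]/(j%:Z%:~R) -rmorphB /=.
rewrite -(dvdz_pcharf ch) -eqz_mod_dvd !modz_nat !modn_small //.
by move=> /eqP[].
Qed.

Lemma mean_swap (R : realFieldType) (d : nat) (f : nat -> nat -> R) :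
  mean d (fun n => mean d (f n)) = mean d (fun i => mean d (f^~ i)).
Proof. by rewrite /mean -!mulr_suml exchange_big. Qed.

Lemma mean3_rot (R : realFieldType) (d : nat) (f : nat -> nat -> nat -> R) :
  mean3 d f = mean d (fun i => mean d (fun j => mean d (fun n => f n i j))).
Proof. by rewrite /mean3 mean_swap; apply: eq_mean => i; rewrite mean_swap. Qed.

(** Primes up to p0 are left out: modulo these the leading coefficient of P may
    vanish, and the density may exceed 1/2. *)
Definition sieved (P : {poly int}) (p0 p n i j : nat) : bool :=
  (p0 < p)%N && (hits P p n i || hits P p n j).

Lemma sieved_periodic P p0 p : periodic3 p (sieved P p0 p).
Proof.
move=> n i j; rewrite /sieved.
have [ei1 ei2] := hits_periodic P p n i; have [ej1 ej2] := hits_periodic P p n j.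
by split; rewrite ?ei1 ?ei2 ?ej1 ?ej2.
Qed.

(** By inclusion-exclusion: each of the two conditions has density 1/p, and
    they hold together only if P(i) = P(j) (mod p), so with density at most
    k/p^2. *)
Lemma sieved_density (R : realFieldType) (P : {poly int}) (k p0 p : nat) :
  prime p -> (p0 < p)%N -> (0 < k)%N -> size P = k.+1 -> (absz (P`_k)%R <= p0)%N ->
  let g := mean3 p (fun n i j => (sieved P p0 p n i j)%:R : R) in
  is_true ((2 - k%:R / p%:R) / p%:R <= g <= 2 / p%:R).
Proof.
move=> pp p0p k0 sP ak g.
have pgt0 := prime_gt0 pp; have pR : (0 : R) < p%:R by rewrite ltr0n.
have uE j : mean p (fun n => (hits P p n j)%:R) = p%:R^-1 :> R by exact: mean_hits.
pose v i j n : R := (hits P p n i && hits P p n j)%:R.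
have gE : g = 2 / p%:R - mean p (fun i => mean p (fun j => mean p (v i j))).
  rewrite /g mean3_rot.
  transitivity (mean p (fun i => mean p (fun j => 2 / p%:R - mean p (v i j)))).
    apply: eq_mean => i; apply: eq_mean => j; rewrite -mulN1r -meanZ.
    have -> : 2 / p%:R = mean p (fun n => (hits P p n i)%:R) +
      mean p (fun n => (hits P p n j)%:R) :> R by rewrite !uE; lra.
    rewrite -!meanD; apply: eq_mean => n; rewrite /sieved p0p /= /v.
    by case: (hits P p n i); case: (hits P p n j) => /=; ring.
  transitivity (mean p (fun i => 2 / p%:R - mean p (fun j => mean p (v i j)))).
    apply: eq_mean => i; rewrite -[in RHS]mulN1r -meanZ.
    rewrite -{2}(mean_cst (2 / p%:R) pgt0) -meanD.
    by apply: eq_mean => j; rewrite mulN1r.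
  rewrite -[in RHS]mulN1r -meanZ -{2}(mean_cst (2 / p%:R) pgt0) -meanD.
  by apply: eq_mean => i; rewrite mulN1r.
have v0 i j : 0 <= mean p (v i j).
  by rewrite -(mean_cst 0 pgt0); apply: ler_mean => n _; rewrite ler0n.
have vle i : mean p (fun j => mean p (v i j)) <= k%:R / p%:R / p%:R.
  apply: (@le_trans _ _ (mean p (fun j =>
     (p%:Z %| P.[i%:Z] - P.[j%:Z])%Z%:R / p%:R))).
    apply: ler_mean => j _.
    case e: (_ %| _)%Z; rewrite ?mul1r.
      rewrite -(uE j); apply: ler_mean => n _.
      by rewrite /v; case: (hits P p n i); rewrite /= ?mul0r.
    rewrite mul0r -(mean_cst 0 pgt0); apply: ler_mean => n _.
    rewrite /v; case hi: (hits P p n i) => //=; case hj: (hits P p n j) => //=.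
    move: e; rewrite -eqz_mod_dvd; move: hi hj; rewrite !hitsE => /eqP <- /eqP <-.
    by rewrite eqxx.
  rewrite /mean -mulr_suml ler_wpM2r ?invr_ge0 ?(ltW pR) //.
  rewrite ler_wpM2r ?invr_ge0 ?(ltW pR) //.
  have ndv : ~~ (p %| absz (P`_k)%R)%N.
    rewrite gtnNdvd //; last exact: leq_ltn_trans p0p.
    rewrite absz_gt0; have := lead_coef_eq0 P; rewrite lead_coefE sP /= => ->.
    by rewrite -size_poly_eq0 sP.
  have := count_roots_modp P.[i%:Z] pp k0 sP ndv.
  rewrite -(ler_nat R); apply: le_trans.
  rewrite -sum1_count natr_sum [leRHS]big_mkcond /index_iota subn0.
  by apply: ler_sum => j _; case: ifP.
have m0 : 0 <= mean p (fun i => mean p (fun j => mean p (v i j))).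
  rewrite -(mean_cst 0 pgt0); apply: ler_mean => i _.
  by rewrite -(mean_cst 0 pgt0); apply: ler_mean => j _.
have m1 : mean p (fun i => mean p (fun j => mean p (v i j))) <= k%:R / p%:R / p%:R.
  by rewrite -[leRHS](mean_cst _ pgt0); apply: ler_mean.
by rewrite gE mulrBl; apply/andP; split; lra.
Qed.

(** From the lower bound for g one gets 1/g - 1 <= (p + k) / 2, by clearing
    denominators and using k < p. *)
Lemma sieved_odds (R : realFieldType) (P : {poly int}) (k p0 p : nat) :
  prime p -> (0 < k)%N -> size P = k.+1 -> (absz (P`_k)%R <= p0)%N -> (k <= p0)%N ->
  (4 <= p0)%N ->
  let g := mean3 p (fun n i j => (sieved P p0 p n i j)%:R : R) in
  (0 <= g <= 2^-1) /\ 
  2 * (if (p <= p0)%N then 0 else (p + k)%:R^-1) <= density_odds g.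
Proof.
move=> pp k0 sP ak kp p4 g.
have [pp0|p0p] := leqP p p0.
  have -> : g = 0.
    rewrite -[RHS](mean3_cst 0 (prime_gt0 pp)); apply: eq_mean3 => n i j.
    by rewrite /sieved ltnNge pp0.
  by rewrite /density_odds mul0r mulr0 lexx invr_ge0 ler0n.
have := sieved_density R pp p0p k0 sP ak; rewrite -/g => /andP[g1 g2].
have pR : (0 : R) < p%:R by rewrite ltr0n prime_gt0.
have p4R : (4 : R) < p%:R by rewrite ltr_nat (leq_ltn_trans p4).
have kpR : (k%:R : R) < p%:R by rewrite ltr_nat (leq_ltn_trans kp).
have kR : (1 : R) <= k%:R by rewrite ler1n.
have kp1 : k%:R / p%:R <= 1 :> R by rewrite ler_pdivrMr // mul1r ltW.
have g0 : 0 <= g by apply: le_trans g1; rewrite divr_ge0 ?(ltW pR) //; lra.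
have gh : g <= 2^-1 by apply: le_trans g2 _; rewrite ler_pdivrMr //; lra.
split; first by rewrite g0.
have g1' : 0 < 1 - g by lra.
rewrite /density_odds ler_pdivlMr //.
have pkR : (0 : R) < (p + k)%:R by rewrite ltr0n addn_gt0 prime_gt0.
suff : 2 * (1 - g) <= g * (p + k)%:R.
  by move=> H; rewrite mulrAC ler_pdivrMr.
rewrite natrD.
move: g1; rewrite ler_pdivrMr // => g1.
have : (2 - k%:R / p%:R) * (p%:R + k%:R + 2) <= g * p%:R * (p%:R + k%:R + 2).
  by rewrite ler_wpM2r //; lra.
have -> : (2 - k%:R / p%:R) * (p%:R + k%:R + 2) = 2 * p%:R + 
   ((k + 4)%:R - (k%:R / p%:R) * (k%:R + 2)) :> R.
  rewrite natrD; field. by rewrite gt_eqF.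
have h3 : (k%:R / p%:R) * (k%:R + 2) <= 1 * (k%:R + 2) :> R.
  by rewrite ler_wpM2r //; lra.
move=> h4; rewrite -subr_ge0 -(pmulr_lge0 _ pR); move: h3 h4; rewrite natrD; lra.
Qed.

(** * The two moments of the number of shifted primes *)

(** The comparison takes place in int, since P.[j] may be negative or exceed n. *)
Definition shifted_prime (P : {poly int}) (z n j : nat) : bool :=
  (z%:Z < n%:Z - P.[j%:Z]) && prime (absz (n%:Z - P.[j%:Z])).

Lemma shifted_prime_no_hits P z n j p :
  shifted_prime P z n j -> prime p -> (p <= z)%N -> ~~ hits P p n j.
Proof.
move=> /andP[zq pq] pp pz; apply/negP; rewrite /hits dvdzE dvdn_prime2 //= => /eqP pE.
have : (z < absz (n%:Z - P.[j%:Z]))%N by rewrite -ltz_nat (lt_le_trans zq) // lez_abs.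
by rewrite -pE ltnNge pz.
Qed.

(** Expanding the square gives the triples (n, i, j) for which n - P(i) and
    n - P(j) are primes exceeding m^2, which no prime up to m^2 removes.  The
    exponent 9 gives 6 z^4 = 6 m^8 <= y for z = m^2, as [box_sieve] requires. *)
Lemma second_moment_bound (R : realType) (P : {poly int}) (k : nat) :
  (0 < k)%N -> size P = k.+1 ->
  exists2 b : R, 0 < b & forall m N y : nat,
    (6 <= m)%N -> (m ^ 9 <= y)%N -> (y <= N)%N ->
    (\sum_(1 <= n < 1 + N)
       (\sum_(y.+1 <= j < y.+1 + y) (shifted_prime P (m ^ 2) n j)%:R) ^+ 2)
      * ln m%:R ^+ 2 <= b * (N * y * y)%:R :> R.
Proof.
move=> k0 sP; pose p0 := maxn (absz (P`_k)%R) (maxn k 4).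
have [kappa kap0 kapP] := sieve_sum_ge_ln2 R k p0.
exists (2 / kappa); first by rewrite divr_gt0.
move=> m N y m6 my yN.
pose g p : R := mean3 p (fun n i j => (sieved P p0 p n i j)%:R).
have gP p : prime p -> (0 <= g p <= 2^-1) /\
    2 * (if (p <= p0)%N then 0 else (p + k)%:R^-1) <= density_odds (g p).
  by move=> pp; apply: sieved_odds => //; rewrite /p0 !leq_max leqnn ?orbT.
have m0 : (0 < m)%N by apply: leq_trans m6.
have L1 := kapP _ m m0 (fun p pp => (gP p pp).2).
set L := sieve_sum _ _ in L1.
pose good n i j := shifted_prime P (m ^ 2) n i && shifted_prime P (m ^ 2) n j.
have S : (\sum_(1 <= n < 1 + N) \sum_(y.+1 <= i < y.+1 + y)
   \sum_(y.+1 <= j < y.+1 + y) (good n i j)%:R) * L <= 2 * (N * y * y)%:R.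
  apply: (@box_sieve R 1 y.+1 N y (m ^ 2) (sieved P p0) good) => //.
  - apply: leq_trans my; rewrite -expnM (expnS m 8) leq_mul2r.
    by rewrite expn_eq0 m6 orbT.
  - by rewrite expn_gt0 m0.
  - by move=> p _; apply: sieved_periodic.
  - by move=> p /gP[].
  move=> n i j p /andP[gi gj] pp pz; rewrite /sieved negb_and negb_or.
  by rewrite !(shifted_prime_no_hits _ pp pz) ?orbT.
set S2 := \sum_(1 <= n < 1 + N) _ in S.
have -> : \sum_(1 <= n < 1 + N)
   (\sum_(y.+1 <= j < y.+1 + y) (shifted_prime P (m ^ 2) n j)%:R) ^+ 2 = S2.
  apply: eq_bigr => n _; rewrite expr2 big_distrlr /=.
  apply: eq_bigr => i _; apply: eq_bigr => j _.
  by rewrite /good -natrM mulnb.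
have S20 : 0 <= S2 by apply: sumr_ge0 => n _; apply: sumr_ge0 => i _; apply: sumr_ge0.
rewrite mulrAC ler_pdivlMr // -mulrA; apply: le_trans S.
by rewrite ler_wpM2l // mulrC.
Qed.

Lemma size_primes_upto_le (z : nat) : (size (primes_upto z) <= z.+1)%N.
Proof. by rewrite size_filter (leq_trans (count_size _ _)) // size_iota. Qed.

(** The primes p in (z, q] give distinct n = p + P(j) <= N. *)
Lemma first_moment_term (R : realType) (P : {poly int}) (z N q j : nat) :
  0 <= P.[j%:Z] -> P.[j%:Z] <= (N - q)%N%:Z -> (q <= N)%N ->
  (size (primes_upto q))%:R - z.+1%:R <=
   \sum_(1 <= n < 1 + N) (shifted_prime P z n j)%:R :> R.
Proof.
move=> P0 PN qN; set v := absz P.[j%:Z].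
have vE : P.[j%:Z] = v%:Z by rewrite gez0_abs.
have vN : (v <= N - q)%N by rewrite -lez_nat -vE.
rewrite lerBlDr -natr_sum -natrD ler_nat.
rewrite -big_mkcond /= sum1_count -!size_filter.
pose s1 := [seq p <- primes_upto q | (p <= z)%N].
pose s2 := [seq p <- primes_upto q | ~~ (p <= z)%N].
have -> : size (primes_upto q) = (size s2 + size s1)%N.
  by rewrite -(count_predC (fun p => p <= z)%N (primes_upto q)) -!size_filter addnC.
have pu : uniq (primes_upto q) by rewrite filter_uniq ?iota_uniq.
apply: leq_add; last first.
  apply: leq_trans (size_primes_upto_le z); apply: uniq_leq_size.
    by rewrite filter_uniq.
  by move=> p; rewrite mem_filter !mem_primes_upto => /and3P[-> ->].
rewrite -(size_map (fun p => p + v)%N s2); apply: uniq_leq_size.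
  by rewrite map_inj_uniq ?(filter_uniq _ pu) // => a b /addIn.
move=> n /mapP[p]; rewrite mem_filter mem_primes_upto -ltnNge => /and3P[zp pp pq] ->.
rewrite mem_filter /shifted_prime vE PoszD addrK /= ltz_nat zp pp /= mem_index_iota.
by have := prime_gt0 pp; lia.
Qed.

(** Where w n < T/2 the bound T/2 is used, and elsewhere the inequality of
    arithmetic and geometric means in the form w <= Q T + w^2 / (4 Q T).  After
    summation the terms other than the one with the count use up only T/2 + T/4
    of the mean T. *)
Lemma second_moment_count (R : realType) (s : seq nat) (w : nat -> R) (T Q : R) :
  0 < T -> 0 < Q -> (forall n, 0 <= w n) ->
  (size s)%:R * T <= \sum_(n <- s) w n ->
  \sum_(n <- s) w n ^+ 2 <= (size s)%:R * (Q * T ^+ 2) ->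
  (size s)%:R <= 4 * Q * (count (fun n => T / 2 <= w n) s)%:R.
Proof.
move=> T0 Q0 w0 S1 S2.
pose E n := T / 2 <= w n.
have key n : w n <= T / 2 + (E n)%:R * (Q * T) + w n ^+ 2 / (4 * (Q * T)).
  have QT : 0 < Q * T by rewrite mulr_gt0.
  have sq : 0 <= w n ^+ 2 / (4 * (Q * T)) by rewrite divr_ge0 ?sqr_ge0 // ltW; lra.
  rewrite /E; case: (leP (T / 2) (w n)) => wT /=; last by rewrite mul0r addr0; lra.
  rewrite mul1r.
  have : 0 <= (w n - 2 * (Q * T)) ^+ 2 / (4 * (Q * T)).
    by rewrite divr_ge0 ?sqr_ge0 // ltW; lra.
  have -> : (w n - 2 * (Q * T)) ^+ 2 / (4 * (Q * T)) =
    w n ^+ 2 / (4 * (Q * T)) - w n + Q * T by field; rewrite !gt_eqF.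
  by lra.
have H : \sum_(n <- s) w n <= (size s)%:R * (T / 2) +
    (count E s)%:R * (Q * T) + (\sum_(n <- s) w n ^+ 2) / (4 * (Q * T)).
  apply: le_trans (ler_sum _ (fun n _ => key n)) _.
  rewrite !big_split /= big_const_seq count_predT iter_addr_0 -[_ *+ _]mulr_natl -!mulr_suml.
  by rewrite -natr_sum -big_mkcond sum1_count.
have QT4 : 0 < 4 * (Q * T) by rewrite !mulr_gt0.
have h2 : (\sum_(n <- s) w n ^+ 2) / (4 * (Q * T)) <= (size s)%:R * (T / 4).
  rewrite ler_pdivrMr //; apply: le_trans S2 _.
  by rewrite le_eqVlt; apply/orP; left; apply/eqP; field.
rewrite -(ler_pM2r T0).
by move: H h2 S1; rewrite -/E; lra.
Qed.

Lemma horner_le (P : {poly int}) (k : nat) : size P = k.+1 ->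
  exists2 A : nat, (0 < A)%N & forall j : nat, (0 < j)%N ->
    P.[j%:Z] <= (A * j ^ k)%N%:Z.
Proof.
move=> sP; exists (\sum_(i < k.+1) absz (P`_i)%R).+1 => // j j0.
apply: (@le_trans _ _ ((\sum_(i < k.+1) absz (P`_i)%R) * j ^ k)%N%:Z); last first.
  by rewrite lez_nat leq_mul2r leqnSn orbT.
rewrite horner_coef sP big_distrl /= (big_morph Posz PoszD (erefl _)).
apply: ler_sum => i _; rewrite PoszM abszE.
apply: (@le_trans _ _ (`|P`_i| * j%:Z ^+ i)).
  by rewrite ler_wpM2r ?exprn_ge0 // ler_norm.
rewrite ler_wpM2l // -!natz -natrX ler_nat leq_pexp2l //.
by rewrite -ltnS.
Qed.

Lemma nat_root (c k n : nat) : (0 < c)%N -> (0 < k)%N ->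
  exists2 y : nat, (c * y ^ k <= n)%N & (n < c * y.+1 ^ k)%N.
Proof.
move=> c0 k0; pose p y := (c * y ^ k <= n)%N.
have ex : exists y, p y by exists 0%N; rewrite /p exp0n ?muln0.
have bd y : p y -> (y <= n)%N.
  move=> py; apply: leq_trans py; apply: leq_trans (leq_pmull _ c0).
  by case: y => [//|y]; rewrite -{1}[y.+1]expn1 leq_pexp2l.
case: (ex_maxnP ex bd) => y py ymax; exists y => //.
by rewrite ltnNge; apply/negP => /ymax; rewrite ltnn.
Qed.

(** Distinct j give distinct pairs (n - P(j), j). *)
Lemma r_ge (P : {poly int}) (n : nat) (z : nat) (s : seq nat) :
  (1 < size P)%N -> 0 < lead_coef P -> uniq s -> all (leq 1) s ->
  (count (shifted_prime P z n) s <= r P n)%N.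
Proof.
move=> sP lP us s0; rewrite /r -size_filter.
rewrite -(size_map (fun j => (absz (n%:Z - P.[j%:Z]), j))).
apply: uniq_leq_size.
  by rewrite map_inj_uniq ?filter_uniq // => i j [].
move=> pj /mapP[j]; rewrite mem_filter => /andP[/andP[zq pq] js] ->.
rewrite in_fset_set; last exact: finite_reprs.
rewrite inE; split => //=; first by have /allP := s0; apply.
by rewrite gez0_abs ?subrK // ltW // (le_lt_trans _ zq).
Qed.

Lemma rich_ge (F : realType) (P : {poly int}) (k : nat) (c x : F) (s : seq nat)
    (p : pred nat) :
  uniq s -> (forall n, n \in s -> p n -> rich P k c x n) ->
  (count p s <= #|` fset_set (rich P k c x)|)%N.
Proof.
move=> us sp; rewrite -size_filter; apply: uniq_leq_size.
  by rewrite filter_uniq.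
move=> n; rewrite mem_filter => /andP[pn ns].
by rewrite in_fset_set ?inE; [apply: sp|exact: finite_rich].
Qed.

(** * Choice of the parameters *)


(** x is at most D y^k <= m (2m)^(9k) <= m^(18k+1). *)
Lemma ln_le_ln_root (R : realType) (x : R) (D k m y : nat) :
  0 < x -> x <= (D * y ^ k)%N%:R -> (y < m.+1 ^ 9)%N -> (D <= m)%N -> (2 <= m)%N ->
  ln x <= (18 * k + 1)%N%:R * ln m%:R.
Proof.
move=> x0 xD ym Dm m2.
have m0 : (0 < m)%N by apply: leq_trans m2.
have mR : (0 : R) < m%:R by rewrite ltr0n.
rewrite mulr_natl -lnXn // ler_ln ?posrE ?exprn_gt0 //.
apply: le_trans xD _; rewrite -natrX ler_nat expnD expn1 mulnC leq_mul //.
rewrite expnM; case: k => [//|k]; rewrite leq_exp2r //.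
apply: leq_trans (ltnW ym) _.
apply: (@leq_trans ((m ^ 2) ^ 9)); last by rewrite -expnM.
rewrite leq_exp2r //; apply: (@leq_trans (m * 2)); first by lia.
by rewrite expnS expn1 leq_mul2l m2 orbT.
Qed.

Lemma root_le (R : realType) (x : R) (D k y : nat) : (0 < k)%N ->
  0 <= x -> x <= (D * y ^ k)%N%:R -> x `^ k%:R^-1 <= D%:R `^ k%:R^-1 * y%:R.
Proof.
move=> k0 x0 xD.
have kR : (0 : R) < k%:R by rewrite ltr0n.
apply: (@le_trans _ _ ((D * y ^ k)%N%:R `^ k%:R^-1)).
  by rewrite ge0_ler_powR ?nnegrE ?invr_ge0.
rewrite natrM natrX powRM ?exprn_ge0 //.
by rewrite -powR_mulrn // -powRrM mulfV ?gt_eqF // powRr1.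
Qed.

(** With q = 2 (N %/ 4) <= N/2, Chebyshev's bound gives N / (16 l) primes, half
    of which remain after the subtraction of z + 1, because z l is O(m^3) while
    N is at least m^9. *)
Lemma prime_count_ge (R : realType) (N z m c : nat) (l : R) :
  0 < l -> ln N%:R <= l -> l <= c%:R * m%:R -> (64 * c <= m)%N -> (2 <= m)%N ->
  (m ^ 9 <= N)%N -> z = (m ^ 2)%N ->
  N%:R / (32 * l) <=
    (size (primes_upto (N %/ 4).*2))%:R - z.+1%:R :> R.
Proof.
move=> l0 lN lm cm m2 mN ->.
have m0 : (0 < m)%N by apply: leq_trans m2.
have N2 : (2 ^ 9 <= N)%N by apply: leq_trans mN; rewrite leq_exp2r.
set q := (N %/ 4)%N.
have q0 : (0 < q)%N by rewrite /q divn_gt0 // (leq_trans _ N2).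
have Nq : (N <= 8 * q)%N by rewrite /q; move: N2; rewrite -[(2 ^ 9)%N]/512%N; lia.
have qN : (q.*2 <= N)%N by rewrite /q; lia.
have ch := chebyshev_lower R q0.
set pi := (size _)%:R in ch *.
have pil : N%:R / 16 <= pi * l.
  apply: (@le_trans _ _ (q%:R / 2)).
    have : N%:R <= (8 * q)%N%:R :> R by rewrite ler_nat.
    by rewrite natrM; lra.
  apply: le_trans ch _; rewrite ler_wpM2l ?ler0n //.
  apply: le_trans lN; rewrite ler_ln ?posrE ?ltr0n ?double_gt0 ?ler_nat //.
  exact: leq_trans N2.
have zl : 32 * ((m ^ 2).+1%:R * l) <= N%:R.
  apply: (@le_trans _ _ (32 * ((2 * m ^ 2)%N%:R * (c%:R * m%:R)))).
    rewrite ler_wpM2l // ler_pM // ?(ltW l0) //.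
    by rewrite ler_nat mul2n -addnn -add1n leq_add2r expn_gt0 m0.
  rewrite -!natrM ler_nat; apply: leq_trans mN.
  have -> : (32 * (2 * m ^ 2 * (c * m)) = 64 * c * m ^ 3)%N by ring.
  apply: (@leq_trans (m * m ^ 3)); first by rewrite leq_mul2r cm orbT.
  by rewrite -expnS leq_pexp2l.
rewrite lerBrDr -(ler_pM2r l0) mulrDl.
have -> : N%:R / (32 * l) * l = N%:R / 32 by field; rewrite gt_eqF.
by lra.
Qed.

Local Open Scope classical_set_scope.

Theorem theorem1p7 (F : realType) (k : nat) (hk : (2 <= k)%N)
    (P : {poly int}) (hP : size P = k.+1) (ha : 0 < P`_k) :
  exists c1 c2 x0 : F, [/\ 0 < c1, 0 < c2, 0 < x0 &
    forall x : F, x0 <= x -> c2 * x <= #|` fset_set (rich P k c1 x)|%:R].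
Proof.
have k0 : (0 < k)%N by apply: leq_trans hk.
have sP : (1 < size P)%N by rewrite hP.
have lP : 0 < lead_coef P by rewrite lead_coefE hP.
have [J HJ] := poly_unbounded 0 sP lP.
have [A A0 HA] := horner_le hP.
have [b b0 Hb] := second_moment_bound F k0 hP.
(* B y^k <= N ensures 2 P(j) <= N for j <= 2y; D y^k bounds x;
   c is the exponent of m in [ln_le_ln_root]. *)
pose B := (A * 2 ^ k.+1)%N; pose D := (B * 2 ^ k)%N; pose c := (18 * k + 1)%N.
(* Lower bound for m beyond which all the estimates hold. *)
have [m0 [m06 m0D m0J m0c]] :
    exists m0, [/\ 6 <= m0, D <= m0, J <= m0 & 64 * c <= m0]%N.
  by exists (6 + D + J + 64 * c)%N; split; lia.
pose beta : F := D%:R `^ k%:R^-1.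
pose Q : F := 32 ^+ 2 * b * c%:R ^+ 2.
have B0 : (0 < B)%N by rewrite muln_gt0 A0 expn_gt0.
have D0 : (0 < D)%N by rewrite muln_gt0 B0 expn_gt0.
have beta0 : 0 < beta by rewrite powR_gt0 // ltr0n.
have cF : (0 : F) < c%:R by rewrite ltr0n /c addn1.
have Q0 : 0 < Q by rewrite !mulr_gt0 ?exprn_gt0.
have m00 : (0 < m0)%N by apply: leq_trans m06.
have [X0 X0E] : exists n, n = (B * (m0 ^ 9) ^ k)%N by eexists.
have X00 : (0 < X0)%N by rewrite X0E muln_gt0 B0 !expn_gt0 m00.
exists (64 * beta)^-1, (8 * Q)^-1, X0%:R.
split; rewrite ?ltr0n // ?invr_gt0 ?mulr_gt0 //.
move=> x xx0.
pose N := Num.truncn x.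
have x1 : 1 <= x.
  by apply: le_trans xx0; rewrite ler1n.
have x0 : 0 <= x by apply: le_trans x1.
have [Nx xN] : N%:R <= x /\ x < N.+1%:R.
  by have /andP[] := truncn_itv x0.
(* y is of order N^(1/k), m of order y^(1/9); the sieve runs up to m^2. *)
have [y yN Ny] := nat_root N B0 k0.
have [m my ym] := nat_root y (isT : 0 < 1)%N (isT : 0 < 9)%N.
rewrite mul1n in my ym.
have mm0 : (m0 <= m)%N.
  rewrite leqNgt; apply/negP => mm0.
  have : (N < X0)%N.
    rewrite X0E; apply: leq_trans Ny _; rewrite leq_mul2l leq_exp2r //; apply/orP; right.
    by apply: leq_trans ym _; rewrite mul1n leq_exp2r.
  by rewrite ltnNge truncn_ge_nat // xx0.
have [m6 Dm Jm cm] : [/\ 6 <= m, D <= m, J <= m & 64 * c <= m]%N.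
  by split; apply: leq_trans mm0.
have m2 : (2 <= m)%N by apply: leq_trans m6.
have m1 : (0 < m)%N by apply: leq_trans m6.
have ley : (m <= y)%N.
  by apply: leq_trans my; rewrite -[X in (X <= _)%N]expn1 leq_pexp2l.
have y0 : (0 < y)%N by apply: leq_trans ley.
have yleN : (y <= N)%N.
  apply: leq_trans yN; apply: leq_trans (leq_pmull _ B0).
  by rewrite -[X in (X <= _)%N]expn1 leq_pexp2l.
have N0 : (0 < N)%N by apply: leq_trans yleN.
have xD : x <= (D * y ^ k)%N%:R.
  apply: le_trans (ltW xN) _; rewrite ler_nat; apply: leq_trans Ny _.
  rewrite /D -mulnA -expnMn leq_mul2l leq_exp2r //.
  by rewrite mul2n -addnn -addn1 leq_add2l y0 orbT.
pose l := ln x.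
have lm : l <= c%:R * ln m%:R.
  by apply: ln_le_ln_root xD _ Dm _; rewrite ?(lt_le_trans ltr01 x1) // -[X in (_ < X)%N]mul1n.
have l0 : 0 < l.
  rewrite ln_gt0 //; apply: lt_le_trans Nx; rewrite ltr1n.
  by apply: leq_trans yleN; apply: leq_trans ley.
have mR : (0 : F) < m%:R by rewrite ltr0n.
have lm0 : 0 < ln m%:R :> F by rewrite ln_gt0 // ltr1n.
(* The minorant w of r, with mean at least T and mean square at most Q T^2. *)
pose w n : F := \sum_(y.+1 <= j < y.+1 + y) (shifted_prime P (m ^ 2) n j)%:R.
pose s := index_iota 1 (1 + N).
have ss : size s = N by rewrite size_iota addKn.
pose T := y%:R / (32 * l).
have yR : (0 : F) < y%:R by rewrite ltr0n.
have T0 : 0 < T by rewrite divr_gt0 ?mulr_gt0.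
have w0 n : 0 <= w n by apply: sumr_ge0.
have S1 : (size s)%:R * T <= \sum_(n <- s) w n.
  rewrite ss exchange_big /=.
  have -> : N%:R * T = \sum_(y.+1 <= j < y.+1 + y) (N%:R / (32 * l)).
    by rewrite sumr_const_nat addKn -mulr_natl /T; field; rewrite gt_eqF.
  rewrite [leLHS]big_nat_cond [leRHS]big_nat_cond.
  apply: ler_sum => j /andP[/andP[yj jy] _].
  apply: le_trans (prime_count_ge (m := m) (c := c) l0 _ _ cm _ _ (erefl _)) _.
  - by rewrite ler_ln ?posrE ?ltr0n //; apply: lt_le_trans x1.
  - apply: le_trans lm _; rewrite ler_wpM2l ?ltW //.
    exact: ln_sublinear.
  - exact: m2.
  - exact: leq_trans yleN.
  have PA : (A * j ^ k * 2 <= N)%N.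
    apply: leq_trans yN; have -> : (B * y ^ k = A * (2 * y) ^ k * 2)%N.
      by rewrite /B expnS expnMn; ring.
    rewrite leq_mul2r leq_mul2l leq_exp2r //=; apply/orP; right.
    by rewrite mul2n -addnn -ltnS -addSn.
  clear - HA HJ PA yj ley Jm.
  apply: first_moment_term.
  - by apply/ltW/HJ; lia.
  - by apply: le_trans (HA j _) _; lia.
  - by lia.
have S2 : \sum_(n <- s) w n ^+ 2 <= (size s)%:R * (Q * T ^+ 2).
  have := Hb m N y m6 my yleN; rewrite -/w ss !natrM => H.
  have -> : N%:R * (Q * T ^+ 2) =
     b * (N%:R * y%:R * y%:R) / (l / c%:R) ^+ 2 :> F.
    by rewrite /Q /T; field; rewrite !gt_eqF.
  rewrite ler_pdivlMr ?exprn_gt0 ?divr_gt0 //.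
  apply: le_trans H; rewrite ler_wpM2l //.
    by apply: sumr_ge0 => n _; rewrite sqr_ge0.
  have lc : l / c%:R <= ln m%:R by rewrite ler_pdivrMr // mulrC.
  by rewrite lerXn2r // nnegrE ltW // divr_gt0.
(* This gives N/(4Q) integers n with T/2 <= w n; the constant
   (64 beta)^-1 brings the required lower bound for r(n) below T/2. *)
have main := second_moment_count T0 Q0 w0 S1 S2.
rewrite ss in main.
rewrite mulrC ler_pdivrMr ?mulr_gt0 //.
apply: (@le_trans _ _ (2 * N%:R)).
  apply: le_trans (ltW xN) _; rewrite -natr1.
  have : (1 : F) <= N%:R by rewrite ler1n.
  by lra.
set cnt := (count _ s)%:R in main.
suff : cnt <= #|` fset_set (rich P k (64 * beta)^-1 x)|%:R.
  by move=> H; have : 4 * Q * cnt <= 4 * Q * #|` fset_set (rich P k (64 * beta)^-1 x)|%:R;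
    [rewrite ler_wpM2l // ltW ?mulr_gt0 | lra].
rewrite ler_nat; apply: rich_ge; first exact: iota_uniq.
move=> n; rewrite mem_index_iota => /andP[n1 nN] Tw; split=> //.
  by apply: le_trans Nx; rewrite ler_nat -ltnS.
apply: le_trans (_ : w n <= _); last first.
  rewrite /w -natr_sum -big_mkcond sum1_count ler_nat.
  apply: r_ge => //; first exact: iota_uniq.
  by apply/allP => j; rewrite mem_index_iota => /andP[/(leq_trans _)->].
apply: le_trans Tw; have -> : T / 2 = (64 * beta)^-1 * (beta * y%:R / l).
  by rewrite /T; field; rewrite !gt_eqF.
rewrite ler_wpM2l ?invr_ge0 ?mulr_ge0 ?(ltW beta0) //.
by rewrite ler_wpM2r ?invr_ge0 ?(ltW l0) // root_le.
Qed.
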